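(* Let $\Omega\subset\mathbb{C}$ be a simply connected domain, let $h:\Omega\to\mathbb{R}$ be a harmonic function and let $\mathfrak{H}$ be a holomorphic 2-form on $\Omega$ (identified with a holomorphic function $\mathfrak{H}:\Omega\to\mathbb{C}$ via the coordinate $z$). Suppose that $L,P:\Omega\to\mathbb{C}$ are two holomorphic functions such that $$L_zP_z+(h_z)^2=\mathfrak{H}\quad\text{on }\Omega$$ and $$|L_z|\neq|P_z|\quad\text{at every point of }\Omega.$$ Then the map $X:\Omega\to\mathbb{C}\times\mathbb{R}\equiv\mathbb{R}^3$ given by $X(z)=(L(z)+\overline{P(z)},\,h(z))$ is a harmonic immersion with Hopf differential $\mathfrak{H}$.
   Context: Write $z=x+iy$. The Wirtinger operators are normalized without the factor $1/2$: $\partial_z:=\frac{\partial}{\partial x}-i\frac{\partial}{\partial y}$, $\partial_{\bar z}:=\frac{\partial}{\partial x}+i\frac{\partial}{\partial y}$, and subscripts $z,\bar z$ denote application of these operators (so $L_z=\partial_z L$, etc.). $\mathbb{R}^3$ is identified with $\mathbb{C}\times\mathbb{R}$ via $(X_1,X_2,X_3)\mapsto(X_1+iX_2,X_3)$. A map $X=(X_1,X_2,X_3):\Omega\to\mathbb{R}^3$ is a harmonic immersion if it is an immersion and each $X_j$ is a harmonic function on $\Omega$ (with respect to $\Delta=\partial_{xx}+\partial_{yy}$). With $\phi_j:=\partial_zX_j$, the Hopf differential of a harmonic immersion $X$ is $\sum_{j=1}^3\phi_j^2$. *)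

(* Defs.v *)
From Stdlib Require Import Reals.
From Coquelicot Require Import Coquelicot.

Open Scope R_scope.

Definition connected_set (D : C -> Prop) : Prop :=
  forall U V : C -> Prop,
    open U -> open V ->
    (forall z, D z -> U z \/ V z) ->
    (exists z, D z /\ U z) ->
    (exists z, D z /\ V z) ->
    exists z, D z /\ U z /\ V z.

Definition plane_domain (D : C -> Prop) : Prop :=
  (exists z, D z) /\ open D /\ connected_set D.

Definition unit_itv (t : R) : Prop := 0 <= t <= 1.

Definition unit_square (p : R * R) : Prop := unit_itv (fst p) /\ unit_itv (snd p).

(* Only the values of [g] on [0,1] matter: [continuous_on] is relative
   continuity. *)
Definition loop_in (D : C -> Prop) (g : R -> C) : Prop :=
  continuous_on unit_itv g /\ (forall t, unit_itv t -> D (g t)) /\ g 0 = g 1.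

Definition null_homotopic_in (D : C -> Prop) (g : R -> C) : Prop :=
  exists H : R * R -> C,
    continuous_on unit_square H /\
    (forall p, unit_square p -> D (H p)) /\
    (forall t, unit_itv t -> H (0, t) = g t) /\
    (forall t, unit_itv t -> H (1, t) = g 0) /\
    (forall s, unit_itv s -> H (s, 0) = g 0 /\ H (s, 1) = g 0).

(* Path-connectedness is automatic for an open connected subset of the plane. *)
Definition simply_connected_domain (D : C -> Prop) : Prop :=
  plane_domain D /\ forall g : R -> C, loop_in D g -> null_homotopic_in D g.

Definition partial_x (u : C -> R) (z : C) : R := Derive (fun t => u (t, Im z)) (Re z).
Definition partial_y (u : C -> R) (z : C) : R := Derive (fun t => u (Re z, t)) (Im z).

Definition has_partials (u : C -> R) (z : C) : Prop :=
  ex_derive (fun t => u (t, Im z)) (Re z) /\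
  ex_derive (fun t => u (Re z, t)) (Im z).

Fixpoint Ck_on (k : nat) (D : C -> Prop) (u : C -> R) : Prop :=
  (forall z, D z -> continuous u z) /\
  match k with
  | O => True
  | S k' =>
      (forall z, D z -> has_partials u z) /\
      Ck_on k' D (partial_x u) /\ Ck_on k' D (partial_y u)
  end.

Definition smooth_on (D : C -> Prop) (u : C -> R) : Prop := forall k, Ck_on k D u.

Definition harmonic_on (D : C -> Prop) (u : C -> R) : Prop :=
  Ck_on 2 D u /\
  forall z, D z -> partial_x (partial_x u) z + partial_y (partial_y u) z = 0.

(* Complex differentiability at every point: the scalars are [C_AbsRing]. *)
Definition holomorphic_on (D : C -> Prop) (f : C -> C) : Prop :=
  forall z, D z -> ex_derive (K := C_AbsRing) (V := C_NormedModule) f z.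

(* No factor 1/2: this is d/dx - i d/dy, so for holomorphic [f] it is twice the
   complex derivative. *)
Definition dz (f : C -> C) (z : C) : C :=
  ((partial_x (fun w => Re (f w)) z, partial_x (fun w => Im (f w)) z)
   - Ci * (partial_y (fun w => Re (f w)) z, partial_y (fun w => Im (f w)) z))%C.

Definition dz_real (u : C -> R) : C -> C := dz (fun w => RtoC (u w)).

(* R^3 is C * R, via (x1, x2, x3) |-> (x1 + i x2, x3). *)
Definition X1 (X : C -> C * R) (z : C) : R := Re (fst (X z)).
Definition X2 (X : C -> C * R) (z : C) : R := Im (fst (X z)).
Definition X3 (X : C -> C * R) (z : C) : R := snd (X z).

(* [dX] is the real Frechet differential of [X] at [z]. *)
Definition immersion_on (D : C -> Prop) (X : C -> C * R) : Prop :=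
  (smooth_on D (X1 X) /\ smooth_on D (X2 X) /\ smooth_on D (X3 X)) /\
  forall z, D z ->
    exists dX : C -> C * R,
      filterdiff (K := R_AbsRing) (U := C_R_NormedModule)
        (V := prod_NormedModule R_AbsRing C_R_NormedModule R_NormedModule)
        X (locally z) dX /\
      forall v w : C, dX v = dX w -> v = w.

Definition harmonic_immersion_on (D : C -> Prop) (X : C -> C * R) : Prop :=
  immersion_on D X /\
  harmonic_on D (X1 X) /\ harmonic_on D (X2 X) /\ harmonic_on D (X3 X).

Definition hopf_differential (X : C -> C * R) (z : C) : C :=
  (dz_real (X1 X) z ^ 2 + dz_real (X2 X) z ^ 2 + dz_real (X3 X) z ^ 2)%C.

(* Main.v *)
Require Import Defs.
From Stdlib Require Import Reals Lra Psatz ssreflect ClassicalEpsilon.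
From Coquelicot Require Import Coquelicot.

(** Put [l = L'] and [p = P'], so [dz L = 2 l] and [dz P = 2 p].  The coordinates [X1], [X2] are
    the real parts of the holomorphic functions [L + P] and [-i (L - P)], whence
    [dz X1 ^ 2 + dz X2 ^ 2 = (l + p)^2 - (l - p)^2 = 4 l p = dz L * dz P], and the Jacobian
    determinant of [(X1, X2)] is [|l|^2 - |p|^2], which does not vanish.

    Smoothness rests on the fact that complex derivatives are holomorphic.  By bisection
    (Goursat), a holomorphic [f] has a primitive [F] on each small square.  For a primitive [F],
    put [A r = int_0^2pi F(z + r e^it) e^-it dt] and [M r = int_0^2pi f(z + r e^it) dt].
    Integration by parts gives [A r = r M r], and differentiation under the integral gives
    [A' = M]; so [A r / r] is constant, equal to its limit [2 pi f(z)] at [0].  The formula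
    [f(z) = A r / (2 pi r)] can be differentiated in [z] with no assumption on [f] but continuity,
    hence [f'] is continuous.  As [f] is now a primitive of the continuous function [f'], the
    same argument shows that [f'] is holomorphic.  For [h] it is applied to
    [h_x - i h_y]. *)

(** * Complex derivatives and complex-valued integrals *)

Local Notation is_Cderive := (is_derive (K := C_AbsRing) (V := C_NormedModule)).
Local Notation C_R := C_R_CompleteNormedModule.
Local Notation Ccontinuous f z := (continuous (f : C_UniformSpace -> C_UniformSpace) z).

Lemma Cmod_bound_fst (z : C) : Rabs (fst z) <= Cmod z.
Proof. apply: Rle_trans (Rmax_Cmod z). exact: Rmax_l. Qed.

Lemma Cmod_bound_snd (z : C) : Rabs (snd z) <= Cmod z.
Proof. apply: Rle_trans (Rmax_Cmod z). exact: Rmax_r. Qed.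

Lemma Cmod_le_sum (z : C) : Cmod z <= Rabs (fst z) + Rabs (snd z).
Proof.
  case: z => x y /=.
  replace ((x, y) : C) with ((x, 0) + (0, y))%C
    by (rewrite /Cplus /=; f_equal; ring).
  apply: Rle_trans (Cmod_triangle _ _) _; rewrite /Cmod /=.
  apply: Rplus_le_compat; right; rewrite -sqrt_Rsqr_abs /Rsqr; f_equal; ring.
Qed.

Lemma norm_C_R (z : C) : norm (z : C_R) = Cmod z.
Proof.
  rewrite /norm /= /prod_norm /Cmod; f_equal.
  by apply: f_equal2; apply: pow2_abs.
Qed.

(** Scalars and values both carry the norm [Cmod] here, so the filter statement becomes the usual
    epsilon-delta one, in which the estimates on complex derivatives are carried out. *)
Lemma is_Cderive_eps (f : C -> C) (z l : C) :
  is_Cderive f z l <->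
  forall eps, 0 < eps -> exists d, 0 < d /\ forall w, Cmod (w - z) < d ->
    Cmod (f w - f z - l * (w - z)) <= eps * Cmod (w - z).
Proof.
  split.
  - move=> [_ D] e e0.
    have [d Hd] := D z (fun P H => H) (mkposreal e e0).
    exists d; split; first exact: cond_pos.
    move=> w Hw; have := Hd w Hw.
    rewrite /norm /= /minus /= /plus /opp /scal /= /mult /= /Cminus => H.
    by rewrite (Cmult_comm l).
  - move=> D; split; first exact: is_linear_scal_l.
    move=> x Hx e.
    (* The definition asks for the estimate at every limit [x] of the filter [locally z]; by
       uniqueness of limits, [z] is the only one. *)
    have -> : x = z.
      symmetry; apply: (is_filter_lim_locally_unique (K := C_AbsRing) (V := AbsRing_NormedModule C_AbsRing)).
      exact: Hx.
    have [d [d0 Hd]] := D e (cond_pos e).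
    exists (mkposreal d d0) => w Hw; have := Hd w Hw.
    rewrite /norm /= /minus /= /plus /opp /scal /= /mult /= /Cminus => H.
    by rewrite (Cmult_comm _ l).
Qed.

(** The balls of [C_UniformSpace] are squares, whereas [Cmod] measures discs. A disc lies in the
    square with the same radius as half-side, and a square of half-side [e / 2] lies in the disc of
    radius [e]. *)
Lemma continuous_C_eps (f : C -> C) (z : C) :
  continuous (f : C_UniformSpace -> C_UniformSpace) z <->
  forall eps, 0 < eps -> exists d, 0 < d /\ forall w, Cmod (w - z) < d ->
    Cmod (f w - f z) < eps.
Proof.
  split.
  - move=> H e e0.
    have e2 : 0 < e / 2 by lra.
    have [d Hd] := H _ (locally_ball (f z) (mkposreal _ e2)).
    exists d; split; first exact: cond_pos.
    move=> w Hw.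
    case: (Hd w).
      by split; [have := Cmod_bound_fst (w - z) | have := Cmod_bound_snd (w - z)];
        rewrite /ball /= /AbsRing_ball /abs /= /minus /plus /opp /= /Rminus => ?; lra.
    rewrite /ball /= /AbsRing_ball /abs /= /minus /plus /opp /= => H1 H2.
    have := Cmod_le_sum (f w - f z); rewrite /= /Rminus; lra.
  - move=> H P [e He].
    have [d [d0 Hd]] := H e (cond_pos e).
    have d2 : 0 < d / 2 by lra.
    exists (mkposreal _ d2) => w [/= H1 H2].
    apply: He.
    move: H1 H2; rewrite /ball /= /AbsRing_ball /abs /= /minus /plus /opp /= => H1 H2.
    have Hw : Cmod (w - z) < d by have := Cmod_le_sum (w - z); rewrite /= /Rminus; lra.
    by have := Hd w Hw; split; rewrite /ball /= /AbsRing_ball /abs /= /minus /plus /opp /=;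
      [have := Cmod_bound_fst (f w - f z) | have := Cmod_bound_snd (f w - f z)];
      rewrite /= /Rminus => ?; lra.
Qed.

Lemma is_derive_RC_eps (f : R -> C) (x : R) (l : C) :
  is_derive (f : R -> C_R) x l <->
  forall eps, 0 < eps -> exists d, 0 < d /\ forall y, Rabs (y - x) < d ->
    Cmod (f y - f x - l * RtoC (y - x)) <= eps * Rabs (y - x).
Proof.
  have E (y : R) :
     norm (minus (minus (f y) (f x)) (scal (minus y x) (l : C_R)) : C_R) =
     Cmod (f y - f x - l * RtoC (y - x)).
    rewrite norm_C_R; f_equal.
    case: (f y) (f x) l => [a b] [c d] [p q].
    rewrite /minus /plus /opp /scal /= /prod_plus /prod_opp /prod_scal /plus /opp /scal
      /= /mult /= /Cminus /Cplus /Copp /Cmult /RtoC /=; f_equal; ring.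
  split.
  - move=> [_ D] e e0.
    have [d Hd] := D x (fun P H => H) (mkposreal e e0).
    exists d; split; first exact: cond_pos.
    by move=> y Hy; rewrite -E; apply: (Hd y Hy).
  - move=> D; split; first exact: is_linear_scal_l.
    move=> y Hy e.
    have -> : y = x.
      symmetry; apply: (is_filter_lim_locally_unique (K := R_AbsRing) (V := R_NormedModule)).
      exact: Hy.
    have [d [d0 Hd]] := D e (cond_pos e).
    exists (mkposreal d d0) => w Hw; rewrite E; exact: (Hd w Hw).
Qed.

(** A chain rule across two scalar fields, complex outside and real inside. The error splits into
    that of [F] at [g t] and [l] times that of [g]. *)
Lemma is_derive_comp_path (F : C -> C) (g : R -> C) (t : R) (l v : C) :
  is_Cderive F (g t) l -> is_derive (g : R -> C_R) t v ->
  is_derive ((fun s => F (g s)) : R -> C_R) t (l * v)%C.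
Proof.
  move=> /is_Cderive_eps HF /is_derive_RC_eps Hg.
  apply/is_derive_RC_eps => e e0.
  have l0 := Cmod_ge_0 l; have v0 := Cmod_ge_0 v.
  (* Both tolerances are chosen so that each part of the error is at most [e / 2 * Rabs (s - t)].
     The cap [1] in [e2] gives the Lipschitz bound [Cmod v + 1] for [g] near [t]. *)
  set e1 := e / (2 * (Cmod v + 1)).
  have e10 : 0 < e1 by apply: Rdiv_lt_0_compat; lra.
  set e2 := Rmin 1 (e / (2 * (Cmod l + 1))).
  have e20 : 0 < e2 by apply: Rmin_pos; [lra | apply: Rdiv_lt_0_compat; lra].
  have [d1 [d10 H1]] := HF e1 e10.
  have [d2 [d20 H2]] := Hg e2 e20.
  exists (Rmin d2 (d1 / (Cmod v + 1))); split.
    by apply: Rmin_pos => //; apply: Rdiv_lt_0_compat; lra.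
  move=> s Hs.
  have {}H2 := H2 s (Rlt_le_trans _ _ _ Hs (Rmin_l _ _)).
  have Hgs : Cmod (g s - g t) <= (Cmod v + 1) * Rabs (s - t).
    replace (g s - g t)%C with ((g s - g t - v * RtoC (s - t)) + v * RtoC (s - t))%C by ring.
    apply: Rle_trans (Cmod_triangle _ _) _.
    rewrite Cmod_mult Cmod_R.
    have : e2 <= 1 by apply: Rmin_l.
    have := Rabs_pos (s - t); nra.
  have Hd : Cmod (g s - g t) < d1.
    apply: Rle_lt_trans Hgs _.
    have := Rlt_le_trans _ _ _ Hs (Rmin_r _ _).
    move=> /(Rmult_lt_compat_l (Cmod v + 1) _ _ ltac:(lra)).
    by have -> : (Cmod v + 1) * (d1 / (Cmod v + 1)) = d1 by field; lra.
  have {}H1 := H1 _ Hd.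
  replace (F (g s) - F (g t) - l * v * RtoC (s - t))%C with
    ((F (g s) - F (g t) - l * (g s - g t)) + l * (g s - g t - v * RtoC (s - t)))%C by ring.
  apply: Rle_trans (Cmod_triangle _ _) _.
  rewrite Cmod_mult.
  have A1 : e1 * ((Cmod v + 1) * Rabs (s - t)) = e / 2 * Rabs (s - t)
    by rewrite /e1; field; lra.
  have A2 : (Cmod l + 1) * (e2 * Rabs (s - t)) <= e / 2 * Rabs (s - t).
    rewrite -Rmult_assoc; apply: Rmult_le_compat_r; first exact: Rabs_pos.
    have -> : e / 2 = (Cmod l + 1) * (e / (2 * (Cmod l + 1))) by field; lra.
    apply: Rmult_le_compat_l; [lra | exact: Rmin_r].
  have := Rmult_le_compat_l e1 _ _ (Rlt_le _ _ e10) Hgs.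
  have := Cmod_ge_0 (g s - g t - v * RtoC (s - t)).
  nra.
Qed.

Lemma is_Cderive_continuous (f : C -> C) (z l : C) :
  is_Cderive f z l -> continuous (f : C_UniformSpace -> C_UniformSpace) z.
Proof.
  move=> /is_Cderive_eps H; apply/continuous_C_eps => e e0.
  have l0 := Cmod_ge_0 l.
  have [d [d0 Hd]] := H 1 Rlt_0_1.
  exists (Rmin d (e / (Cmod l + 2))); split.
    by apply: Rmin_pos => //; apply: Rdiv_lt_0_compat; lra.
  move=> w Hw.
  have {}Hd := Hd w (Rlt_le_trans _ _ _ Hw (Rmin_l _ _)).
  replace (f w - f z)%C with ((f w - f z - l * (w - z)) + l * (w - z))%C by ring.
  apply: Rle_lt_trans (Cmod_triangle _ _) _; rewrite Cmod_mult.
  have := Rlt_le_trans _ _ _ Hw (Rmin_r _ _).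
  move=> /(Rmult_lt_compat_l (Cmod l + 2) _ _ ltac:(lra)).
  have -> : (Cmod l + 2) * (e / (Cmod l + 2)) = e by field; lra.
  have := Cmod_ge_0 (w - z); nra.
Qed.

(** [C_R] is a module over the reals, so a complex factor is not one of its scalars; the product is
    expanded into real and imaginary parts. *)
Lemma is_RInt_Cmult (c : C) (f : R -> C) (a b : R) (l : C) :
  is_RInt (f : R -> C_R) a b l ->
  is_RInt ((fun t => (c * f t)%C) : R -> C_R) a b (c * l)%C.
Proof.
  move=> H.
  have H1 := is_RInt_fct_extend_fst (U := R_NormedModule) (V := R_NormedModule) f a b l H.
  have H2 := is_RInt_fct_extend_snd (U := R_NormedModule) (V := R_NormedModule) f a b l H.
  apply: (is_RInt_fct_extend_pair (U := R_NormedModule) (V := R_NormedModule)).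
  - apply: is_RInt_minus; exact: is_RInt_scal.
  - apply: is_RInt_plus; exact: is_RInt_scal.
Qed.

Lemma Cmod_RInt_le (f : R -> C) (a b M : R) (l : C) :
  (forall t, Rmin a b <= t <= Rmax a b -> Cmod (f t) <= M) ->
  is_RInt (f : R -> C_R) a b l -> Cmod l <= M * Rabs (b - a).
Proof.
  move=> HM Hf; rewrite -norm_C_R Rmult_comm.
  apply: (norm_RInt_le_const_abs (V := C_R) f a b l M) => // t Ht.
  rewrite norm_C_R; exact: HM.
Qed.

Lemma continuous_RC_components (u : R -> C) (t : R) :
  continuous (u : R -> C_R) t <->
  continuous (fun s => fst (u s)) t /\ continuous (fun s => snd (u s)) t.
Proof.
  split.
  - move=> H; split.
    + apply: (continuous_comp (V := C_UniformSpace) u fst) => //.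
      case: (u t) => a b; exact: continuous_fst.
    + apply: (continuous_comp (V := C_UniformSpace) u snd) => //.
      case: (u t) => a b; exact: continuous_snd.
  - move=> [H1 H2].
    apply: (continuous_ext (fun s => (fst (u s), snd (u s)))).
      by move=> s; case: (u s).
    apply: (continuous_comp_2 _ _ (fun a b : R => (a, b) : C_UniformSpace) t H1 H2).
    apply: (continuous_ext (fun p : R * R => p)); first by case.
    exact: continuous_id.
Qed.

Lemma is_derive_RC_components (u : R -> C) (t : R) (l : C) :
  is_derive (u : R -> C_R) t l <->
  is_derive (fun s => fst (u s)) t (fst l) /\ is_derive (fun s => snd (u s)) t (snd l).
Proof.
  split.
  - move=> H; split.
    + apply: (filterdiff_comp' (V := C_R_NormedModule) (W := R_NormedModule) u fst t _ fst H).
      apply: filterdiff_linear; exact: is_linear_fst.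
    + apply: (filterdiff_comp' (V := C_R_NormedModule) (W := R_NormedModule) u snd t _ snd H).
      apply: filterdiff_linear; exact: is_linear_snd.
  - move=> [H1 H2].
    apply: (is_derive_ext (V := C_R) (fun s => (fst (u s), snd (u s)) : C_R)).
      by move=> s; case: (u s).
    rewrite (surjective_pairing l).
    apply: (filterdiff_comp'_2 (W := C_R_NormedModule) _ _ (fun a b : R => (a, b) : C_R_NormedModule)
       t _ _ (fun a b : R => (a, b) : C_R_NormedModule) H1 H2).
    apply: (filterdiff_ext (fun p : R * R => p : C_R_NormedModule)); first by case.
    apply: (filterdiff_ext_lin _ (fun p : R * R => p : C_R_NormedModule)); last by case.
    exact: filterdiff_id.
Qed.

Lemma continuous_RC_Cmult (u v : R -> C) (t : R) :
  continuous (u : R -> C_R) t -> continuous (v : R -> C_R) t ->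
  continuous ((fun s => u s * v s)%C : R -> C_R) t.
Proof.
  move=> /continuous_RC_components [H1 H2] /continuous_RC_components [H3 H4].
  apply/continuous_RC_components; split; rewrite /=.
  - apply: (continuous_minus (V := R_NormedModule)); exact: (continuous_mult (K := R_AbsRing)).
  - apply: (continuous_plus (V := R_NormedModule)); exact: (continuous_mult (K := R_AbsRing)).
Qed.

Lemma is_derive_RC_Cmult (u v : R -> C) (t : R) (u' v' : C) :
  is_derive (u : R -> C_R) t u' -> is_derive (v : R -> C_R) t v' ->
  is_derive ((fun s => u s * v s)%C : R -> C_R) t (u' * v t + u t * v')%C.
Proof.
  move=> /is_derive_RC_components [H1 H2] /is_derive_RC_components [H3 H4].
  have M (p q : R -> R) (p' q' : R) : is_derive p t p' -> is_derive q t q' ->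
     is_derive (fun s => p s * q s) t (p' * q t + p t * q').
    by move=> Hp Hq; apply: (is_derive_mult p q) => // n m; exact: Rmult_comm.
  apply/is_derive_RC_components; split; rewrite /=.
  - evar_last.
      apply: (is_derive_minus (V := R_NormedModule)); apply: M; eassumption.
    rewrite /minus /plus /opp /=; ring.
  - evar_last.
      apply: (is_derive_plus (V := R_NormedModule)); apply: M; eassumption.
    rewrite /plus /=; ring.
Qed.

Lemma continuous_RC_derive (g : R -> C) (t : R) (l : C) :
  is_derive (g : R -> C_R) t l -> continuous (g : R -> C_R) t.
Proof. by move=> H; apply: (ex_derive_continuous (V := C_R)); exists l. Qed.

Lemma continuous_path (f : C -> C) (g : R -> C) (t : R) :
  Ccontinuous f (g t) -> ex_derive (g : R -> C_R) t ->
  continuous ((fun s => f (g s)) : R -> C_R) t.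
Proof.
  move=> Hf Hg.
  apply: (continuous_comp (U := R_UniformSpace) (V := C_UniformSpace) (W := C_UniformSpace) g f) => //.
  exact: (ex_derive_continuous (V := C_R) g t Hg).
Qed.

(** The fundamental theorem of calculus applied to [F] composed with [g], whose derivative comes
    from the chain rule. *)
Lemma is_RInt_path (F f : C -> C) (g g' : R -> C) (a b : R) :
  (forall t, Rmin a b <= t <= Rmax a b ->
     is_Cderive F (g t) (f (g t)) /\ Ccontinuous f (g t) /\
     is_derive (g : R -> C_R) t (g' t) /\ continuous (g' : R -> C_R) t) ->
  is_RInt ((fun t => f (g t) * g' t)%C : R -> C_R) a b (F (g b) - F (g a))%C.
Proof.
  move=> H; apply: (is_RInt_derive (V := C_R) (fun t => F (g t))) => t /H [H1 [H2 [H3 H4]]].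
    exact: is_derive_comp_path.
  apply: continuous_RC_Cmult => //.
  by apply: continuous_path => //; exists (g' t).
Qed.

(** * Goursat's theorem on rectangles *)

Definition hpath (y : R) (t : R) : C := (t, y).
Definition vpath (x : R) (t : R) : C := (x, t).

Lemma is_derive_hpath (y t : R) : is_derive (hpath y : R -> C_R) t (RtoC 1).
Proof.
  apply/is_derive_RC_eps => e e0; exists 1; split; first lra.
  move=> s _; have -> : (hpath y s - hpath y t - RtoC 1 * RtoC (s - t) = 0)%C.
    rewrite /hpath /RtoC /Cminus /Cplus /Copp /Cmult /=; f_equal; ring.
  rewrite Cmod_0; apply: Rmult_le_pos; [lra | exact: Rabs_pos].
Qed.

Lemma is_derive_vpath (x t : R) : is_derive (vpath x : R -> C_R) t Ci.
Proof.
  apply/is_derive_RC_eps => e e0; exists 1; split; first lra.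
  move=> s _; have -> : (vpath x s - vpath x t - Ci * RtoC (s - t) = 0)%C.
    rewrite /vpath /RtoC /Ci /Cminus /Cplus /Copp /Cmult /=; f_equal; ring.
  rewrite Cmod_0; apply: Rmult_le_pos; [lra | exact: Rabs_pos].
Qed.

(** Contour integrals of [f(z) dz] along axis-parallel segments; on a vertical one [dz = i dt],
    hence the factor [Ci] in [vseg]. *)
Definition hseg (f : C -> C) (y a b : R) : C := RInt (V := C_R) (fun t => f (hpath y t)) a b.
Definition vseg (f : C -> C) (x c d : R) : C :=
  (Ci * RInt (V := C_R) (fun t => f (vpath x t)) c d)%C.
(** The contour integral over the boundary of [[a, b] x [c, d]], counterclockwise: bottom, right,
    top reversed, left reversed. *)
Definition rect_int (f : C -> C) (a b c d : R) : C :=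
  (hseg f c a b + vseg f b c d - hseg f d a b - vseg f a c d)%C.

Lemma ex_RInt_path (f : C -> C) (g : R -> C) (lo hi a b : R) :
  (forall t, lo <= t <= hi -> Ccontinuous f (g t)) ->
  (forall t, ex_derive (g : R -> C_R) t) ->
  lo <= a <= hi -> lo <= b <= hi ->
  ex_RInt ((fun t => f (g t)) : R -> C_R) a b.
Proof.
  move=> Hf Hg Ha Hb; apply: (ex_RInt_continuous (V := C_R)) => t Ht.
  apply: continuous_path => //; apply: Hf.
  by move: Ht; rewrite /Rmin /Rmax; case: Rle_dec => ?; lra.
Qed.

Lemma hseg_Chasles (f : C -> C) (y lo hi a b c : R) :
  (forall t, lo <= t <= hi -> Ccontinuous f (t, y)) ->
  lo <= a <= hi -> lo <= b <= hi -> lo <= c <= hi ->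
  (hseg f y a b + hseg f y b c)%C = hseg f y a c.
Proof.
  move=> Hf Ha Hb Hc.
  have E t : ex_derive (hpath y : R -> C_R) t by eexists; exact: is_derive_hpath.
  by apply: (RInt_Chasles (V := C_R)); apply: (ex_RInt_path f (hpath y) lo hi).
Qed.

Lemma vseg_Chasles (f : C -> C) (x lo hi a b c : R) :
  (forall t, lo <= t <= hi -> Ccontinuous f (x, t)) ->
  lo <= a <= hi -> lo <= b <= hi -> lo <= c <= hi ->
  (vseg f x a b + vseg f x b c)%C = vseg f x a c.
Proof.
  move=> Hf Ha Hb Hc.
  have E t : ex_derive (vpath x : R -> C_R) t by eexists; exact: is_derive_vpath.
  rewrite /vseg -Cmult_plus_distr_l; f_equal.
  by apply: (RInt_Chasles (V := C_R)); apply: (ex_RInt_path f (vpath x) lo hi).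
Qed.

(** The two integrals over the cut [x = m] have opposite signs and cancel. *)
Lemma rect_int_split_x (f : C -> C) (a m b c d : R) :
  a <= m <= b -> c <= d ->
  (forall x y, a <= x <= b -> c <= y <= d -> Ccontinuous f (x, y)) ->
  rect_int f a b c d = (rect_int f a m c d + rect_int f m b c d)%C.
Proof.
  move=> Hm Hcd Hf; rewrite /rect_int.
  rewrite -(hseg_Chasles f c a b a m b); try lra; last by move=> t Ht; apply: Hf; lra.
  rewrite -(hseg_Chasles f d a b a m b); try lra; last by move=> t Ht; apply: Hf; lra.
  ring.
Qed.

Lemma rect_int_split_y (f : C -> C) (a b c m d : R) :
  a <= b -> c <= m <= d ->
  (forall x y, a <= x <= b -> c <= y <= d -> Ccontinuous f (x, y)) ->
  rect_int f a b c d = (rect_int f a b c m + rect_int f a b m d)%C.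
Proof.
  move=> Hm Hcd Hf; rewrite /rect_int.
  rewrite -(vseg_Chasles f a c d c m d); try lra; last by move=> t Ht; apply: Hf; lra.
  rewrite -(vseg_Chasles f b c d c m d); try lra; last by move=> t Ht; apply: Hf; lra.
  ring.
Qed.

Lemma RInt_path_primitive (F f : C -> C) (g : R -> C) (g' : C) (a b : R) :
  (forall z, is_Cderive F z (f z)) -> (forall z, Ccontinuous f z) ->
  (forall t, is_derive (g : R -> C_R) t g') ->
  (g' * RInt (V := C_R) (fun t => f (g t)) a b)%C = (F (g b) - F (g a))%C.
Proof.
  move=> HF Hf Hg.
  have Ex : ex_RInt ((fun t => f (g t)) : R -> C_R) a b.
    apply: (ex_RInt_continuous (V := C_R)) => t _.
    by apply: continuous_path => //; exists g'.
  have I := is_RInt_Cmult g' _ _ _ _ (RInt_correct (V := C_R) _ _ _ Ex).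
  rewrite -(is_RInt_unique (V := C_R) _ _ _ _ I).
  apply: (is_RInt_unique (V := C_R)).
  apply: (is_RInt_ext (V := C_R) (fun t => f (g t) * g')%C).
    by move=> t _; exact: Cmult_comm.
  apply: (is_RInt_path F f g (fun _ => g')) => t _.
  by split; [|split; [|split]] => //; exact: continuous_const.
Qed.

(** Each side contributes a difference of values of [F] at two corners, and the four differences
    cancel. *)
Lemma rect_int_primitive (F f : C -> C) (a b c d : R) :
  (forall z, is_Cderive F z (f z)) -> (forall z, Ccontinuous f z) ->
  rect_int f a b c d = 0%C.
Proof.
  move=> HF Hf; rewrite /rect_int /hseg /vseg.
  have H y := RInt_path_primitive F f (hpath y) (RtoC 1) a b HF Hf (is_derive_hpath y).
  have V x := RInt_path_primitive F f (vpath x) Ci c d HF Hf (is_derive_vpath x).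
  rewrite !V -(Cmult_1_l (RInt (V := C_R) (fun t => f (hpath c t)) a b))
    -(Cmult_1_l (RInt (V := C_R) (fun t => f (hpath d t)) a b)) !H.
  rewrite /hpath /vpath; ring.
Qed.

(** An affine function has a quadratic primitive. In Goursat's argument this disposes of the
    first-order part of [f]. *)
Lemma rect_int_affine (a b c d : R) (p q w : C) :
  rect_int (fun z => p + q * (z - w))%C a b c d = 0%C.
Proof.
  apply: (rect_int_primitive (fun z => p * z + q / 2 * (z - w) * (z - w))%C) => z.
    apply/is_Cderive_eps => e e0.
    have q0 := Cmod_ge_0 (q / 2).
    exists (e / (Cmod (q / 2) + 1)); split; first by apply: Rdiv_lt_0_compat; lra.
    move=> v Hv.
    have -> : (p * v + q / 2 * (v - w) * (v - w) - (p * z + q / 2 * (z - w) * (z - w)) -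
      (p + q * (z - w)) * (v - z) = q / 2 * (v - z) * (v - z))%C.
      field; move=> H; have := f_equal fst H; rewrite /=; lra.
    rewrite 2!Cmod_mult; apply: Rmult_le_compat_r; first exact: Cmod_ge_0.
    have := Rmult_lt_compat_l (Cmod (q / 2) + 1) _ _ ltac:(lra) Hv.
    have -> : (Cmod (q / 2) + 1) * (e / (Cmod (q / 2) + 1)) = e by field; lra.
    have := Cmod_ge_0 (v - z); nra.
  apply: (is_Cderive_continuous _ z q).
  apply/is_Cderive_eps => e e0; exists 1; split; first lra.
  move=> v _.
  have -> : (p + q * (v - w) - (p + q * (z - w)) - q * (v - z) = 0)%C by ring.
  rewrite Cmod_0; apply: Rmult_le_pos; [lra | exact: Cmod_ge_0].
Qed.

Lemma is_RInt_path_minus (f g : C -> C) (p : R -> C) (lo hi a b : R) :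
  (forall t, lo <= t <= hi -> Ccontinuous f (p t)) ->
  (forall t, lo <= t <= hi -> Ccontinuous g (p t)) ->
  (forall t, ex_derive (p : R -> C_R) t) ->
  lo <= a <= hi -> lo <= b <= hi ->
  is_RInt ((fun t => (f (p t) - g (p t))%C) : R -> C_R) a b
   (RInt (V := C_R) (fun t => f (p t)) a b - RInt (V := C_R) (fun t => g (p t)) a b)%C.
Proof.
  move=> Hf Hg Hp Ha Hb.
  apply: (is_RInt_minus (V := C_R)); apply: (RInt_correct (V := C_R)).
  exact: (ex_RInt_path f p lo hi). exact: (ex_RInt_path g p lo hi).
Qed.

Lemma Cmod_path_minus_le (f g : C -> C) (p : R -> C) (lo hi a b M : R) :
  (forall t, lo <= t <= hi -> Ccontinuous f (p t)) ->
  (forall t, lo <= t <= hi -> Ccontinuous g (p t)) ->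
  (forall t, ex_derive (p : R -> C_R) t) ->
  lo <= a <= hi -> lo <= b <= hi ->
  (forall t, Rmin a b <= t <= Rmax a b -> Cmod (f (p t) - g (p t)) <= M) ->
  Cmod (RInt (V := C_R) (fun t => f (p t)) a b - RInt (V := C_R) (fun t => g (p t)) a b)
  <= M * Rabs (b - a).
Proof.
  move=> Hf Hg Hp Ha Hb HM.
  apply: (Cmod_RInt_le (fun t => f (p t) - g (p t))%C a b M) => //.
  exact: (is_RInt_path_minus f g p lo hi).
Qed.

Lemma Cmod_Ci : Cmod Ci = 1.
Proof. rewrite /Cmod /Ci /=; have -> : 0 * (0 * 1) + 1 * (1 * 1) = 1 by ring. exact: sqrt_1. Qed.

(** Subtracting the affine approximation at [w] leaves the integral unchanged. The remainder is at
    most [e] times the half-perimeter, which bounds the distance to [w], and the boundary is twice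
    the half-perimeter long. *)
Lemma rect_int_local (f : C -> C) (a b c d e : R) (w l : C) :
  a <= b -> c <= d -> a <= fst w <= b -> c <= snd w <= d -> 0 <= e ->
  (forall x y, a <= x <= b -> c <= y <= d -> Ccontinuous f (x, y)) ->
  (forall x y, a <= x <= b -> c <= y <= d ->
     Cmod (f (x, y) - f w - l * ((x, y) - w)) <= e * Cmod ((x, y) - w)) ->
  Cmod (rect_int f a b c d) <= 2 * e * ((b - a) + (d - c)) ^ 2.
Proof.
  move=> Hab Hcd Hw1 Hw2 He Hf HL.
  set g : C -> C := fun z => (f w + l * (z - w))%C.
  have Hg z : Ccontinuous g z.
    apply: (is_Cderive_continuous _ z l).
    apply/is_Cderive_eps => e' e0; exists 1; split; first lra.
    move=> v _; have -> : (g v - g z - l * (v - z) = 0)%C by rewrite /g; ring.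
    rewrite Cmod_0; apply: Rmult_le_pos; [lra | exact: Cmod_ge_0].
  have HM x y : a <= x <= b -> c <= y <= d ->
     Cmod (f (x, y) - g (x, y)) <= e * ((b - a) + (d - c)).
    move=> Hx Hy.
    have -> : (f (x, y) - g (x, y) = f (x, y) - f w - l * ((x, y) - w))%C by rewrite /g; ring.
    apply: Rle_trans (HL x y Hx Hy) _; apply: Rmult_le_compat_l => //.
    apply: Rle_trans (Cmod_le_sum _) _; rewrite /=.
    by apply: Rplus_le_compat; apply: Rabs_le; lra.
  have Z := rect_int_affine a b c d (f w) l w.
  have Hh y : c <= y <= d -> Cmod (hseg f y a b - hseg g y a b) <=
     e * ((b - a) + (d - c)) * (b - a).
    move=> Hy; rewrite -{2}(Rabs_pos_eq (b - a)); last lra.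
    apply: (Cmod_path_minus_le f g (hpath y) a b); try lra.
    - by move=> t Ht; apply: Hf.
    - by move=> t _.
    - by move=> t; eexists; exact: is_derive_hpath.
    - by move=> t; rewrite Rmin_left ?Rmax_right // => Ht; apply: HM.
  have Hv x : a <= x <= b -> Cmod (vseg f x c d - vseg g x c d) <=
     e * ((b - a) + (d - c)) * (d - c).
    move=> Hx; rewrite -{2}(Rabs_pos_eq (d - c)); last lra.
    have E (u v : C) : (Ci * u - Ci * v = Ci * (u - v))%C by ring.
    rewrite /vseg E Cmod_mult Cmod_Ci Rmult_1_l.
    apply: (Cmod_path_minus_le f g (vpath x) c d); try lra.
    - by move=> t Ht; apply: Hf.
    - by move=> t _.
    - by move=> t; eexists; exact: is_derive_vpath.
    - by move=> t; rewrite Rmin_left ?Rmax_right // => Ht; apply: HM.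
  have -> : rect_int f a b c d = ((hseg f c a b - hseg g c a b) + (vseg f b c d - vseg g b c d)
     + - (hseg f d a b - hseg g d a b) + - (vseg f a c d - vseg g a c d))%C.
    transitivity (rect_int f a b c d - rect_int g a b c d)%C; first by rewrite Z; ring.
    rewrite /rect_int; ring.
  apply: Rle_trans (Cmod_triangle _ _) _.
  apply: Rle_trans (Rplus_le_compat_r _ _ _ (Cmod_triangle _ _)) _.
  apply: Rle_trans (Rplus_le_compat_r _ _ _ (Rplus_le_compat_r _ _ _ (Cmod_triangle _ _))) _.
  rewrite !Cmod_opp.
  have := Hh c ltac:(lra); have := Hh d ltac:(lra); have := Hv a ltac:(lra); have := Hv b ltac:(lra).
  nra.
Qed.

(** One cut in each direction: by the triangle inequality, one of the two halves keeps at least half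
    of the modulus each time. *)
Lemma rect_int_quarter (f : C -> C) (a b c d : R) :
  a <= b -> c <= d ->
  (forall x y, a <= x <= b -> c <= y <= d -> Ccontinuous f (x, y)) ->
  exists a' c', a <= a' /\ a' + (b - a) / 2 <= b /\ c <= c' /\ c' + (d - c) / 2 <= d /\
    Cmod (rect_int f a b c d) / 4 <=
    Cmod (rect_int f a' (a' + (b - a) / 2) c' (c' + (d - c) / 2)).
Proof.
  move=> Hab Hcd Hf.
  have [a' [A1 [A2 A3]]] : exists a', a <= a' /\ a' + (b - a) / 2 <= b /\
     Cmod (rect_int f a b c d) / 2 <= Cmod (rect_int f a' (a' + (b - a) / 2) c d).
    have E := rect_int_split_x f a (a + (b - a) / 2) b c d ltac:(lra) Hcd Hf.
    have T := Cmod_triangle (rect_int f a (a + (b - a) / 2) c d)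
      (rect_int f (a + (b - a) / 2) b c d).
    rewrite -E in T.
    case: (Rle_dec (Cmod (rect_int f a b c d) / 2)
             (Cmod (rect_int f a (a + (b - a) / 2) c d))) => H.
      by exists a; split; [|split]; lra.
    exists (a + (b - a) / 2); split; [|split]; try lra.
    have -> : a + (b - a) / 2 + (b - a) / 2 = b by field.
    lra.
  have {}Hf x y : a' <= x <= a' + (b - a) / 2 -> c <= y <= d -> Ccontinuous f (x, y).
    by move=> Hx Hy; apply: Hf; lra.
  set b' := a' + (b - a) / 2 in A2 A3 Hf *.
  have Hb' : a' <= b' by rewrite /b'; lra.
  exists a'.
  have E := rect_int_split_y f a' b' c (c + (d - c) / 2) d Hb' ltac:(lra) Hf.
  have T := Cmod_triangle (rect_int f a' b' c (c + (d - c) / 2))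
    (rect_int f a' b' (c + (d - c) / 2) d).
  rewrite -E in T.
  case: (Rle_dec (Cmod (rect_int f a' b' c d) / 2)
             (Cmod (rect_int f a' b' c (c + (d - c) / 2)))) => H.
    by exists c; rewrite -/b'; repeat split; lra.
  exists (c + (d - c) / 2); rewrite -/b'.
  have -> : c + (d - c) / 2 + (d - c) / 2 = d by field.
  by repeat split; lra.
Qed.

(** The point is the supremum of [u]: by monotonicity every [v n] bounds the whole sequence [u] from
    above. *)
Lemma nested_intervals (u : nat -> R) (v : nat -> R) :
  (forall n, u n <= u (S n)) -> (forall n, v (S n) <= v n) -> (forall n, u n <= v n) ->
  exists x, forall n, u n <= x <= v n.
Proof.
  move=> Hu Hv Huv.
  have Mu n k : u n <= u (k + n)%nat.
    by elim: k => [|k IH] /=; [lra | apply: Rle_trans IH (Hu _)].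
  have Mv n k : v (k + n)%nat <= v n.
    by elim: k => [|k IH] /=; [lra | apply: Rle_trans (Hv _) IH].
  have B n k : u k <= v n.
    apply: Rle_trans (Mu k n) _; rewrite Nat.add_comm.
    by apply: Rle_trans (Huv _) _.
  case: (completeness (fun x => exists n, x = u n)).
  - by exists (v O) => _ [n ->].
  - by exists (u O), O.
  - move=> x [Hx1 Hx2]; exists x => n; split; first by apply: Hx1; exists n.
    by apply: Hx2 => _ [k ->].
Qed.

(** Quartering is iterated from the given rectangle, and [w] is found by nested intervals in each
    coordinate. *)
Lemma rect_int_bisection (f : C -> C) (a b c d : R) :
  a <= b -> c <= d ->
  (forall x y, a <= x <= b -> c <= y <= d -> Ccontinuous f (x, y)) ->
  exists (w : C), a <= fst w <= b /\ c <= snd w <= d /\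
    forall n, exists a' c', a <= a' /\ a' + (b - a) / 2 ^ n <= b /\
      c <= c' /\ c' + (d - c) / 2 ^ n <= d /\
      a' <= fst w <= a' + (b - a) / 2 ^ n /\ c' <= snd w <= c' + (d - c) / 2 ^ n /\
      Cmod (rect_int f a b c d) / 4 ^ n <=
      Cmod (rect_int f a' (a' + (b - a) / 2 ^ n) c' (c' + (d - c) / 2 ^ n)).
Proof.
  move=> Hab Hcd Hf.
  (* [p] is the lower left corner of the rectangle at stage [n]. The side lengths depend on [n]
     alone, so the corner is all that the recursion has to carry. *)
  pose good n (p : R * R) := a <= fst p /\ fst p + (b - a) / 2 ^ n <= b /\
      c <= snd p /\ snd p + (d - c) / 2 ^ n <= d /\
      Cmod (rect_int f a b c d) / 4 ^ n <=
      Cmod (rect_int f (fst p) (fst p + (b - a) / 2 ^ n) (snd p) (snd p + (d - c) / 2 ^ n)).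
  have P2 n : 0 < 2 ^ n by apply: pow_lt; lra.
  have W n : 0 <= (b - a) / 2 ^ n by apply: Rdiv_le_0_compat; [lra | exact: P2].
  have W' n : 0 <= (d - c) / 2 ^ n by apply: Rdiv_le_0_compat; [lra | exact: P2].
  have S2 n x : x / 2 ^ S n = x / 2 ^ n / 2 by rewrite /=; field; have := P2 n; lra.
  (* [rect_int_quarter] only asserts existence; indefinite description turns it into a function that
     can be iterated, with the invariant kept in the subset type. *)
  have step n (p : {p | good n p}) : {q : {q | good (S n) q} |
     fst (proj1_sig p) <= fst (proj1_sig q) /\
     fst (proj1_sig q) + (b - a) / 2 ^ S n <= fst (proj1_sig p) + (b - a) / 2 ^ n /\
     snd (proj1_sig p) <= snd (proj1_sig q) /\
     snd (proj1_sig q) + (d - c) / 2 ^ S n <= snd (proj1_sig p) + (d - c) / 2 ^ n}.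
    apply: constructive_indefinite_description.
    case: p => [[x y] [/= G1 [G2 [G3 [G4 G5]]]]].
    have [|||x' [y' [H1 [H2 [H3 [H4 H5]]]]]] := rect_int_quarter f x (x + (b - a) / 2 ^ n) y (y + (d - c) / 2 ^ n).
    - have := W n; lra.
    - have := W' n; lra.
    - by move=> s t Hs Ht; apply: Hf; lra.
    move: H2 H4 H5.
    have E z u : z + u - z = u by ring.
    rewrite !E -!S2 => H2 H4 H5.
    have G : good (S n) (x', y').
      repeat split; rewrite /= -/(pow 2 (S n)) -/(pow 4 (S n)); try lra.
      apply: Rle_trans H5.
      have -> : Cmod (rect_int f a b c d) / 4 ^ S n = Cmod (rect_int f a b c d) / 4 ^ n / 4.
        by rewrite /=; field; apply: pow_nonzero; lra.
      lra.
    by exists (exist _ _ G); rewrite /= -/(pow 2 (S n)).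
  have G0 : good O (a, c).
    have E z u : z + (u - z) / 2 ^ 0 = u by rewrite /=; field.
    rewrite /good; cbn [fst snd]; rewrite !E.
    have -> : 4 ^ 0 = 1 by []. repeat split; lra.
  pose s := nat_rect (fun n => {p | good n p}) (exist _ _ G0) (fun n p => proj1_sig (step n p)).
  have Hs n := proj2_sig (step n (s n)).
  have Gs n := proj2_sig (s n).
  have [x Hx] := nested_intervals (fun n => fst (proj1_sig (s n)))
    (fun n => fst (proj1_sig (s n)) + (b - a) / 2 ^ n)
    (fun n => proj1 (Hs n)) (fun n => proj1 (proj2 (Hs n))) ltac:(move=> n; have := W n; lra).
  have [y Hy] := nested_intervals (fun n => snd (proj1_sig (s n)))
    (fun n => snd (proj1_sig (s n)) + (d - c) / 2 ^ n)
    (fun n => proj1 (proj2 (proj2 (Hs n)))) (fun n => proj2 (proj2 (proj2 (Hs n))))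
    ltac:(move=> n; have := W' n; lra).
  exists (x, y); cbn [fst snd].
  have := Hx O; have := Hy O; have := Gs O; rewrite /good => G00 Hy0 Hx0.
  split; [lra | split; [lra |]] => n.
  exists (fst (proj1_sig (s n))), (snd (proj1_sig (s n))).
  have := Hx n; have := Hy n; have := Gs n; rewrite /good => Gn Hyn Hxn.
  by repeat split; lra.
Qed.

(** Near [w] the function is affine up to [e], so a late rectangle of the bisection has an integral
    of at most [2 * e * (D / 2 ^ n) ^ 2]. The factor [4 ^ n] lost in the bisection cancels, and [e]
    is arbitrary. *)
Lemma goursat (f : C -> C) (a b c d : R) :
  a <= b -> c <= d ->
  (forall x y, a <= x <= b -> c <= y <= d -> exists l, is_Cderive f (x, y) l) ->
  rect_int f a b c d = 0%C.
Proof.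
  move=> Hab Hcd Hd.
  have Hf x y : a <= x <= b -> c <= y <= d -> Ccontinuous f (x, y).
    by move=> Hx Hy; case: (Hd x y Hx Hy) => l; exact: is_Cderive_continuous.
  have [[x y] [/= Hx [Hy HB]]] := rect_int_bisection f a b c d Hab Hcd Hf.
  have [l /is_Cderive_eps Hl] := Hd x y Hx Hy.
  set D := (b - a) + (d - c).
  have D0 : 0 <= D by rewrite /D; lra.
  have key e : 0 < e -> Cmod (rect_int f a b c d) <= 2 * e * D ^ 2.
    move=> e0.
    have [r [r0 Hr]] := Hl e e0.
    have [n Hn] : exists n, D / 2 ^ n < r.
      have [n Hn] := Pow_x_infinity 2 ltac:(rewrite Rabs_pos_eq; lra) (D / r + 1).
      exists n; have := Hn n (le_n n).
      have P2 : 0 < 2 ^ n by apply: pow_lt; lra.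
      rewrite Rabs_pos_eq; last lra.
      move=> H; apply: (Rmult_lt_reg_r (2 ^ n)) => //.
      have -> : D / 2 ^ n * 2 ^ n = D by field; lra.
      have E : r * (D / r) = D by field; lra.
      nra.
    have [a' [c' [H1 [H2 [H3 [H4 [H5 [H6 H7]]]]]]]] := HB n.
    have P2 : 0 < 2 ^ n by apply: pow_lt; lra.
    have W : 0 <= (b - a) / 2 ^ n by apply: Rdiv_le_0_compat; lra.
    have W' : 0 <= (d - c) / 2 ^ n by apply: Rdiv_le_0_compat; lra.
    have DE : D / 2 ^ n = (b - a) / 2 ^ n + (d - c) / 2 ^ n by rewrite /D; field; lra.
    have Loc : Cmod (rect_int f a' (a' + (b - a) / 2 ^ n) c' (c' + (d - c) / 2 ^ n))
       <= 2 * e * (D / 2 ^ n) ^ 2.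
      have -> : D / 2 ^ n = (a' + (b - a) / 2 ^ n - a') + (c' + (d - c) / 2 ^ n - c')
        by rewrite DE; ring.
      apply: (rect_int_local _ _ _ _ _ _ (x, y) l); cbn [fst snd]; try lra.
        by move=> s t Hs Ht; apply: Hf; lra.
      move=> s t Hs Ht; apply: Hr.
      apply: Rle_lt_trans (Cmod_le_sum _) _; rewrite /=.
      apply: Rle_lt_trans Hn; rewrite DE.
      by apply: Rplus_le_compat; apply: Rabs_le; lra.
    have E4 : 4 ^ n = 2 ^ n * 2 ^ n by rewrite -Rpow_mult_distr; f_equal; ring.
    have P4 : 0 < 4 ^ n by rewrite E4; nra.
    have := Rmult_le_compat_r (4 ^ n) _ _ (Rlt_le _ _ P4) (Rle_trans _ _ _ H7 Loc).
    have -> : Cmod (rect_int f a b c d) / 4 ^ n * 4 ^ n = Cmod (rect_int f a b c d)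
      by field; lra.
    have -> : 2 * e * (D / 2 ^ n) ^ 2 * 4 ^ n = 2 * e * D ^ 2 by rewrite E4; field; lra.
    by [].
  apply: Cmod_eq_0; apply: Rle_antisym; last exact: Cmod_ge_0.
  apply: Rnot_lt_le => Hpos.
  (* This [e] makes the bound at most half of the modulus itself; the [+ 1] keeps the denominator
     positive when the rectangle is a single point. *)
  have := key (Cmod (rect_int f a b c d) / (2 * (2 * (D ^ 2 + 1)))).
  have D2 : 0 <= D ^ 2 by nra.
  set M := Cmod _ in Hpos *.
  move=> /(_ ltac:(apply: Rdiv_lt_0_compat; lra)).
  have -> : 2 * (M / (2 * (2 * (D ^ 2 + 1)))) * D ^ 2 = M / 2 * (D ^ 2 / (D ^ 2 + 1))
    by field; lra.
  have : D ^ 2 / (D ^ 2 + 1) <= 1 by apply: (proj1 (Rdiv_le_1 _ _ _)); lra.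
  nra.
Qed.

(** * Local primitives *)

(** Closed squares rather than discs: they contain the axis-parallel paths between their points, and
    they are products of intervals, as the uniform continuity theorem in two variables requires. *)
Definition cbox (z0 : C) (rho : R) (z : C) :=
  Rabs (fst z - fst z0) <= rho /\ Rabs (snd z - snd z0) <= rho.

(** Exchanging [a] and [b], or [c] and [d], only changes the sign of the integral. This form serves
    for increments, which may point in any direction. *)
Lemma goursat_unordered (f : C -> C) (a b c d : R) :
  (forall x y, Rmin a b <= x <= Rmax a b -> Rmin c d <= y <= Rmax c d ->
     exists l, is_Cderive f (x, y) l) ->
  rect_int f a b c d = 0%C.
Proof.
  have Hx a' b' c' d' : b' <= a' ->
    (forall x y, b' <= x <= a' -> Rmin c' d' <= y <= Rmax c' d' -> Ccontinuous f (x, y)) ->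
    rect_int f a' b' c' d' = (- rect_int f b' a' c' d')%C.
    move=> Hab Hf; rewrite /rect_int.
    have S y : Rmin c' d' <= y <= Rmax c' d' -> hseg f y a' b' = (- hseg f y b' a')%C.
      move=> Hy; symmetry; apply: (opp_RInt_swap (V := C_R)).
      apply: (ex_RInt_path f (hpath y) b' a'); try lra.
        by move=> t Ht; exact: Hf.
      by move=> t; eexists; exact: is_derive_hpath.
    rewrite (S c') ?(S d'); try ring.
      by split; [exact: Rmin_r | exact: Rmax_r].
    by split; [exact: Rmin_l | exact: Rmax_l].
  have Hy a' b' c' d' : d' <= c' ->
    (forall x y, Rmin a' b' <= x <= Rmax a' b' -> d' <= y <= c' -> Ccontinuous f (x, y)) ->
    rect_int f a' b' c' d' = (- rect_int f a' b' d' c')%C.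
    move=> Hab Hf; rewrite /rect_int.
    have S x : Rmin a' b' <= x <= Rmax a' b' -> vseg f x c' d' = (- vseg f x d' c')%C.
      move=> Hx'; rewrite /vseg.
      have -> : (- (Ci * RInt (V := C_R) (fun s => f (vpath x s)) d' c') =
         Ci * - RInt (V := C_R) (fun s => f (vpath x s)) d' c')%C by ring.
      f_equal; symmetry; apply: (opp_RInt_swap (V := C_R)).
      apply: (ex_RInt_path f (vpath x) d' c'); try lra.
        by move=> t Ht; exact: Hf.
      by move=> t; eexists; exact: is_derive_vpath.
    rewrite (S a') ?(S b'); try ring.
      by split; [exact: Rmin_r | exact: Rmax_r].
    by split; [exact: Rmin_l | exact: Rmax_l].
  have Z : (- 0 = 0)%C by ring.
  move=> Hd.
  have Hc x y : Rmin a b <= x <= Rmax a b -> Rmin c d <= y <= Rmax c d -> Ccontinuous f (x, y).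
    by move=> H1 H2; have [l] := Hd x y H1 H2; exact: is_Cderive_continuous.
  case: (Rle_dec a b) => Hab; case: (Rle_dec c d) => Hcd.
  - by move: Hd; rewrite !Rmin_left ?Rmax_right // => Hd; exact: goursat.
  - move: Hd Hc; rewrite (Rmin_left a) ?(Rmax_right a) ?(Rmin_right c) ?(Rmax_left c); try lra.
    move=> Hd Hc; rewrite Hy; try lra.
      by rewrite goursat //; lra.
    by rewrite Rmin_left ?Rmax_right //; lra.
  - move: Hd Hc; rewrite (Rmin_right a) ?(Rmax_left a) ?(Rmin_left c) ?(Rmax_right c); try lra.
    move=> Hd Hc; rewrite Hx; try lra.
      by rewrite goursat //; lra.
    by rewrite Rmin_left ?Rmax_right //; lra.
  - move: Hd Hc; rewrite (Rmin_right a) ?(Rmax_left a) ?(Rmin_right c) ?(Rmax_left c); try lra.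
    move=> Hd Hc; rewrite Hx; try lra.
      rewrite Hy; try lra.
        by rewrite goursat ?Z //; lra.
      by rewrite Rmin_left ?Rmax_right //; lra.
    by rewrite Rmin_right ?Rmax_left //; lra.
Qed.

Lemma between_cball (c r a b t : R) :
  Rabs (a - c) <= r -> Rabs (b - c) <= r -> Rmin a b <= t <= Rmax a b -> Rabs (t - c) <= r.
Proof.
  move=> /Rabs_le_between' Ha /Rabs_le_between' Hb Ht; apply/Rabs_le_between'.
  by move: Ht; rewrite /Rmin /Rmax; case: Rle_dec => ?; lra.
Qed.

Lemma RInt_minus_const_le (f : C -> C) (p : R -> C) (a b e : R) (k : C) :
  (forall t, Rmin a b <= t <= Rmax a b -> Ccontinuous f (p t)) ->
  (forall t, ex_derive (p : R -> C_R) t) ->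
  (forall t, Rmin a b <= t <= Rmax a b -> Cmod (f (p t) - k) <= e) ->
  Cmod (RInt (V := C_R) (fun t => f (p t)) a b - k * RtoC (b - a)) <= e * Rabs (b - a).
Proof.
  move=> Hf Hp He.
  apply: (Cmod_RInt_le (fun t => f (p t) - k)%C a b e) => //.
  apply: (is_RInt_minus (V := C_R)).
    apply: (RInt_correct (V := C_R)).
    by apply: (ex_RInt_path f p (Rmin a b) (Rmax a b)) => //;
      split; (exact: Rmin_l || exact: Rmin_r || exact: Rmax_l || exact: Rmax_r).
  have -> : (k * RtoC (b - a))%C = scal (V := C_R) (b - a) k.
    by case: k {He} => x y; rewrite /RtoC /Cmult /scal /= /prod_scal /scal /= /mult /=; f_equal; ring.
  exact: (is_RInt_const (V := C_R)).
Qed.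

Lemma box_primitive (f : C -> C) (z0 : C) (rho : R) :
  (forall z, cbox z0 rho z -> exists l, is_Cderive f z l) ->
  exists F, forall z, Rabs (fst z - fst z0) < rho -> Rabs (snd z - snd z0) < rho ->
    is_Cderive F z (f z).
Proof.
  move=> Hd.
  have Hc z : cbox z0 rho z -> Ccontinuous f z.
    by move=> /Hd [l]; exact: is_Cderive_continuous.
  (* The primitive integrates [f] from the center of the square, first horizontally and then
     vertically. *)
  exists (fun z => hseg f (snd z0) (fst z0) (fst z) + vseg f (fst z) (snd z0) (snd z))%C.
  move=> [x y]; cbn [fst snd] => Hx Hy.
  have r0 : 0 < rho by have := Rabs_pos (x - fst z0); lra.
  have Hx0 : Rabs (fst z0 - fst z0) <= rho by rewrite Rminus_diag Rabs_R0; lra.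
  have Hy0 : Rabs (snd z0 - snd z0) <= rho by rewrite Rminus_diag Rabs_R0; lra.
  apply/is_Cderive_eps => e e0.
  have e2 : 0 < e / 2 by lra.
  have /continuous_C_eps Hxy : Ccontinuous f (x, y) by apply: Hc; split; rewrite /=; lra.
  have [d1 [d10 Hd1]] := Hxy _ e2.
  (* The half of [d1] puts every point between [(x, y)] and [(x', y')] at distance less than [d1]
     from [(x, y)]; the other two bounds keep [(x', y')] in the square. *)
  set d := Rmin (d1 / 2) (Rmin (rho - Rabs (x - fst z0)) (rho - Rabs (y - snd z0))).
  have D1 : d <= d1 / 2 by exact: Rmin_l.
  have D2 : d <= rho - Rabs (x - fst z0) by apply: Rle_trans (Rmin_r _ _) (Rmin_l _ _).
  have D3 : d <= rho - Rabs (y - snd z0) by apply: Rle_trans (Rmin_r _ _) (Rmin_r _ _).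
  exists d; split; first by repeat apply: Rmin_pos; lra.
  move=> [x' y'] Hw; cbn [fst snd].
  have Wx : Rabs (x' - x) < d by apply: Rle_lt_trans Hw; exact: (Cmod_bound_fst ((x', y') - (x, y))).
  have Wy : Rabs (y' - y) < d by apply: Rle_lt_trans Hw; exact: (Cmod_bound_snd ((x', y') - (x, y))).
  have Hx' : Rabs (x' - fst z0) <= rho.
    have -> : x' - fst z0 = (x' - x) + (x - fst z0) by ring.
    by have := Rabs_triang (x' - x) (x - fst z0); lra.
  have Hy' : Rabs (y' - snd z0) <= rho.
    have -> : y' - snd z0 = (y' - y) + (y - snd z0) by ring.
    by have := Rabs_triang (y' - y) (y - snd z0); lra.
  have [bx by'] : (Rabs (x - fst z0) <= rho /\ Rabs (y - snd z0) <= rho) by lra.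
  (* Goursat on the rectangle with opposite corners [(x, snd z0)] and [(x', y)] turns the increment
     of the primitive into an integral over the short path from [(x, y)] through [(x', y)] to
     [(x', y')]. *)
  have ->: (hseg f (snd z0) (fst z0) x' + vseg f x' (snd z0) y' -
    (hseg f (snd z0) (fst z0) x + vseg f x (snd z0) y) =
     hseg f y x x' + vseg f x' y y')%C.
    have G : rect_int f x x' (snd z0) y = 0%C.
      apply: goursat_unordered => s t Hs Ht; apply: Hd; split; cbn [fst snd].
        exact: (between_cball _ _ x x').
      exact: (between_cball _ _ (snd z0) y).
    have <- : (hseg f (snd z0) (fst z0) x + hseg f (snd z0) x x')%C = hseg f (snd z0) (fst z0) x'.
      apply: (hseg_Chasles _ _ (fst z0 - rho) (fst z0 + rho)); try exact/Rabs_le_between'.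
      by move=> t /Rabs_le_between' Ht; apply: Hc; split.
    have <- : (vseg f x' (snd z0) y + vseg f x' y y')%C = vseg f x' (snd z0) y'.
      apply: (vseg_Chasles _ _ (snd z0 - rho) (snd z0 + rho)); try exact/Rabs_le_between'.
      by move=> t /Rabs_le_between' Ht; apply: Hc; split.
    move: G; rewrite /rect_int => G.
    transitivity (hseg f y x x' + vseg f x' y y' + (hseg f (snd z0) x x' + vseg f x' (snd z0) y -
      hseg f y x x' - vseg f x (snd z0) y))%C; first by ring.
    by rewrite G; ring.
  have P s t : Rmin x x' <= s <= Rmax x x' -> Rmin y y' <= t <= Rmax y y' ->
     Cmod (f (s, t) - f (x, y)) <= e / 2.
    move=> Hs Ht; apply: Rlt_le; apply: Hd1.
    apply: Rle_lt_trans (Cmod_le_sum _) _; rewrite /=.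
    have := between_cball x (Rabs (x' - x)) x x' s.
    rewrite Rminus_diag Rabs_R0 => /(_ (Rabs_pos _) (Rle_refl _) Hs).
    have := between_cball y (Rabs (y' - y)) y y' t.
    rewrite Rminus_diag Rabs_R0 => /(_ (Rabs_pos _) (Rle_refl _) Ht).
    rewrite -/(s - x) -/(t - y); lra.
  have Iy : Rmin y y' <= y <= Rmax y y' by split; [exact: Rmin_l | exact: Rmax_l].
  have Ix' : Rmin x x' <= x' <= Rmax x x' by split; [exact: Rmin_r | exact: Rmax_r].
  have Q1 : Cmod (hseg f y x x' - f (x, y) * RtoC (x' - x)) <= e / 2 * Rabs (x' - x).
    apply: (RInt_minus_const_le f (hpath y)).
    - move=> t Ht; apply: Hc; split; cbn [fst snd hpath] => //.
      exact: (between_cball _ _ x x').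
    - by move=> t; eexists; exact: is_derive_hpath.
    - by move=> t Ht; apply: P.
  have Q2 : Cmod (vseg f x' y y' - f (x, y) * (Ci * RtoC (y' - y))) <= e / 2 * Rabs (y' - y).
    have -> : (vseg f x' y y' - f (x, y) * (Ci * RtoC (y' - y)) =
      Ci * (RInt (V := C_R) (fun t => f (vpath x' t)) y y' - f (x, y) * RtoC (y' - y)))%C.
      rewrite /vseg; ring.
    rewrite Cmod_mult Cmod_Ci Rmult_1_l.
    apply: (RInt_minus_const_le f (vpath x')).
    - move=> t Ht; apply: Hc; split; cbn [fst snd vpath] => //.
      exact: (between_cball _ _ y y').
    - by move=> t; eexists; exact: is_derive_vpath.
    - by move=> t Ht; apply: P.
  have -> : ((x', y') - (x, y) = RtoC (x' - x) + Ci * RtoC (y' - y))%C.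
    by rewrite /RtoC /Ci /Cminus /Cplus /Copp /Cmult /=; f_equal; ring.
  set dx := RtoC (x' - x) in Q1 *; set dy := (Ci * RtoC (y' - y))%C in Q2 *.
  have B1 : Rabs (x' - x) <= Cmod (dx + dy).
    have := Cmod_bound_fst (dx + dy); rewrite /dx /dy /=.
    by have -> : x' - x + (0 * (y' - y) - 1 * 0) = x' - x by ring.
  have B2 : Rabs (y' - y) <= Cmod (dx + dy).
    have := Cmod_bound_snd (dx + dy); rewrite /dx /dy /=.
    by have -> : 0 + (0 * 0 + 1 * (y' - y)) = y' - y by ring.
  have -> : (hseg f y x x' + vseg f x' y y' - f (x, y) * (dx + dy) =
     (hseg f y x x' - f (x, y) * dx) + (vseg f x' y y' - f (x, y) * dy))%C by ring.
  apply: Rle_trans (Cmod_triangle _ _) _; nra.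
Qed.

(** * Integrals over circles *)

(** Heine's theorem for real functions of two variables on a rectangle, applied to the real and the
    imaginary part. *)
Lemma cbox_uniform_continuity (f : C -> C) (z0 : C) (rho e : R) :
  (forall z, cbox z0 rho z -> Ccontinuous f z) -> 0 < e ->
  exists d, 0 < d /\ forall w w', cbox z0 rho w -> cbox z0 rho w' -> Cmod (w' - w) < d ->
    Cmod (f w' - f w) <= e.
Proof.
  move=> Hf e0.
  have e2 : 0 < e / 2 by lra.
  have P (pr : C -> R) : (forall u v : C, Rabs (pr u - pr v) <= Cmod (u - v)) ->
    exists d : posreal, forall w w', cbox z0 rho w -> cbox z0 rho w' -> Cmod (w' - w) < d ->
     Rabs (pr (f w') - pr (f w)) < e / 2.
    move=> Hpr.
    have [|d Hd] := uniform_continuity_2d (fun x y => pr (f (x, y))) (fst z0 - rho) (fst z0 + rho)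
       (snd z0 - rho) (snd z0 + rho) _ (mkposreal _ e2).
      move=> x y /Rabs_le_between' Hx /Rabs_le_between' Hy [e' e'0].
      have /continuous_C_eps H : Ccontinuous f (x, y) by apply: Hf; split.
      have [d [d0 Hd]] := H e' e'0.
      have d2 : 0 < d / 2 by lra.
      exists (mkposreal _ d2) => u v /= Hu Hv.
      apply: Rle_lt_trans (Hpr _ _) _; apply: Hd.
      by apply: Rle_lt_trans (Cmod_le_sum _) _; rewrite /= -/(u - x) -/(v - y); lra.
    exists d => [[x y]] [x' y'] [/= /Rabs_le_between' H1 /Rabs_le_between' H2]
      [/= /Rabs_le_between' H3 /Rabs_le_between' H4] Hm.
    apply: (Hd x y x' y') => //.
      by apply: Rle_lt_trans Hm; exact: (Cmod_bound_fst ((x', y') - (x, y))).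
    by apply: Rle_lt_trans Hm; exact: (Cmod_bound_snd ((x', y') - (x, y))).
  have [d1 H1] := P fst (fun u v => Cmod_bound_fst (u - v)).
  have [d2 H2] := P snd (fun u v => Cmod_bound_snd (u - v)).
  exists (Rmin d1 d2); split; first by apply: Rmin_pos; exact: cond_pos.
  move=> w w' Hw Hw' Hm.
  apply: Rle_trans (Cmod_le_sum _) _.
  have := H1 w w' Hw Hw' (Rlt_le_trans _ _ _ Hm (Rmin_l _ _)).
  have := H2 w w' Hw Hw' (Rlt_le_trans _ _ _ Hm (Rmin_r _ _)).
  rewrite /= /Rminus; lra.
Qed.

Lemma is_derive_segment (w h : C) (t : R) :
  is_derive ((fun s => w + RtoC s * h)%C : R -> C_R) t h.
Proof.
  apply/is_derive_RC_eps => e e0; exists 1; split; first lra.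
  move=> s _; have -> : (w + RtoC s * h - (w + RtoC t * h) - h * RtoC (s - t) = 0)%C.
    by rewrite RtoC_minus; ring.
  rewrite Cmod_0; apply: Rmult_le_pos; [lra | exact: Rabs_pos].
Qed.

Lemma cbox_segment (z0 w w' : C) (rho t : R) :
  cbox z0 rho w -> cbox z0 rho w' -> 0 <= t <= 1 -> cbox z0 rho (w + RtoC t * (w' - w)).
Proof.
  move=> [/Rabs_le_between' H1 /Rabs_le_between' H2] [/Rabs_le_between' H3 /Rabs_le_between' H4] Ht.
  by split; apply/Rabs_le_between'; rewrite /=; nra.
Qed.

(** With [h = w' - w], the remainder is the integral over [[0, 1]] of [(f (w + t h) - f w) * h],
    which uniform continuity of [f] controls. The uniformity in [w] is what permits differentiation
    under the integral over a circle. *)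
Lemma cbox_uniform_differentiability (F f : C -> C) (z0 : C) (rho e : R) :
  (forall z, cbox z0 rho z -> is_Cderive F z (f z)) ->
  (forall z, cbox z0 rho z -> Ccontinuous f z) -> 0 < e ->
  exists d, 0 < d /\ forall w w', cbox z0 rho w -> cbox z0 rho w' -> Cmod (w' - w) < d ->
    Cmod (F w' - F w - f w * (w' - w)) <= e * Cmod (w' - w).
Proof.
  move=> HF Hf e0.
  have [d [d0 Hd]] := cbox_uniform_continuity f z0 rho e Hf e0.
  exists d; split => // w w' Hw Hw' Hm.
  set h := (w' - w)%C in Hm *.
  have Hin t : Rmin 0 1 <= t <= Rmax 0 1 -> cbox z0 rho (w + RtoC t * h).
    rewrite Rmin_left ?Rmax_right; try lra; exact: cbox_segment.
  have I := is_RInt_path F f (fun t => w + RtoC t * h)%C (fun _ => h) 0 1.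
  have {}I : is_RInt ((fun t => f (w + RtoC t * h) * h)%C : R -> C_R) 0 1 (F w' - F w)%C.
    evar_last; first apply: I => t Ht.
      split; [|split; [|split]].
      - by apply: HF; exact: Hin.
      - by apply: Hf; exact: Hin.
      - exact: is_derive_segment.
      - exact: continuous_const.
    rewrite /h; f_equal; last f_equal; f_equal; ring.
  have J : is_RInt ((fun t => (f (w + RtoC t * h) - f w) * h)%C : R -> C_R) 0 1
    (F w' - F w - f w * h)%C.
    apply: (is_RInt_ext (V := C_R) (fun t => minus (f (w + RtoC t * h) * h)%C (f w * h)%C : C_R)).
      by move=> t _; rewrite /minus /plus /opp /=; ring_simplify; rewrite /Cminus.
    apply: (is_RInt_minus (V := C_R)) => //.
    evar_last; first exact: (is_RInt_const (V := C_R)).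
    rewrite Rminus_0_r; exact: (scal_one (V := C_R)).
  have := Cmod_RInt_le _ _ _ (e * Cmod h) _ _ J.
  rewrite Rminus_0_r Rabs_R1 Rmult_1_r; apply=> t Ht.
  rewrite Cmod_mult; apply: Rmult_le_compat_r; first exact: Cmod_ge_0.
  apply: Hd => //; first exact: Hin.
  have -> : (w + RtoC t * h - w = RtoC t * h)%C by ring.
  rewrite Cmod_mult Cmod_R; apply: Rle_lt_trans Hm.
  have : Rabs t <= 1 by move: Ht; rewrite Rmin_left ?Rmax_right; try lra; move=> Ht; apply: Rabs_le; lra.
  have := Cmod_ge_0 h; nra.
Qed.

Definition cis (t : R) : C := (cos t, sin t).
(* [e^(-it)] *)
Definition cisN (t : R) : C := (cos t, - sin t).
Definition circle (z : C) (r t : R) : C := (z + RtoC r * cis t)%C.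

Lemma cis_cisN (t : R) : (cis t * cisN t = 1)%C.
Proof.
  rewrite /cis /cisN /Cmult /RtoC /=; f_equal; last ring.
  have := sin2_cos2 t; rewrite /Rsqr; lra.
Qed.

Lemma Cmod_cis (t : R) : Cmod (cis t) = 1.
Proof.
  rewrite /Cmod /cis /=; have := sin2_cos2 t; rewrite /Rsqr => H.
  have -> : cos t * (cos t * 1) + sin t * (sin t * 1) = 1 by lra.
  exact: sqrt_1.
Qed.

Lemma Cmod_cisN (t : R) : Cmod (cisN t) = 1.
Proof.
  have := f_equal Cmod (cis_cisN t); rewrite Cmod_mult Cmod_cis Cmod_1; lra.
Qed.

Lemma is_derive_circle (z : C) (r t : R) :
  is_derive (circle z r : R -> C_R) t (RtoC r * (Ci * cis t))%C.
Proof.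
  apply/is_derive_RC_components; split; rewrite /=; auto_derive => //; ring.
Qed.

Lemma is_derive_cisN (t : R) : is_derive (cisN : R -> C_R) t (- Ci * cisN t)%C.
Proof.
  apply/is_derive_RC_components; split; rewrite /=; auto_derive => //; ring.
Qed.

(** This explains the recurring bounds [rho / 2]: one half of [rho] is reserved for the center of
    the circle and the other for its radius. *)
Lemma circle_in_cbox (z0 z : C) (rho r t : R) :
  cbox z0 (rho / 2) z -> Rabs r <= rho / 2 -> cbox z0 rho (circle z r t).
Proof.
  move=> [H1 H2] Hr.
  have A x c y : Rabs (x - c) <= rho / 2 -> Rabs y <= 1 -> Rabs (x + r * y - c) <= rho.
    move=> Hx Hy; have -> : x + r * y - c = (x - c) + r * y by ring.
    apply: Rle_trans (Rabs_triang _ _) _; rewrite Rabs_mult.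
    have := Rabs_pos r; have := Rabs_pos y; nra.
  rewrite /circle; split; rewrite /=.
    have -> : r * cos t - 0 * sin t = r * cos t by ring.
    by apply: A => //; apply: Rabs_le; have := COS_bound t; lra.
  have -> : r * sin t + 0 * cos t = r * sin t by ring.
  by apply: A => //; apply: Rabs_le; have := SIN_bound t; lra.
Qed.

(* [circle_mean] and [circle_moment] are the integrals [M] and [A] of the header: neither is
   divided by [2 pi]. *)
Definition circle_mean (f : C -> C) (z : C) (r : R) : C :=
  RInt (V := C_R) (fun t => f (circle z r t)) 0 (2 * PI).
Definition circle_moment (f : C -> C) (z : C) (r : R) : C :=
  RInt (V := C_R) (fun t => f (circle z r t) * cisN t)%C 0 (2 * PI).

Lemma two_PI_bound : 0 < 2 * PI <= 8.
Proof. have := PI_RGT_0; have := PI_4; lra. Qed.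

(** The factor 8 is a crude bound for the length [2 * PI] of the interval. *)
Lemma Cmod_RInt_circle_le (g : R -> C) (e : R) (l : C) :
  0 <= e -> (forall t, Cmod (g t) <= e) -> is_RInt (g : R -> C_R) 0 (2 * PI) l ->
  Cmod l <= 8 * e.
Proof.
  move=> e0 He Hg; have B := two_PI_bound.
  have := Cmod_RInt_le g 0 (2 * PI) e l (fun t _ => He t) Hg.
  rewrite Rminus_0_r Rabs_pos_eq; nra.
Qed.

Lemma continuous_on_circle (f : C -> C) (z0 z : C) (rho r t : R) :
  (forall z, cbox z0 rho z -> Ccontinuous f z) ->
  cbox z0 (rho / 2) z -> Rabs r <= rho / 2 ->
  continuous ((fun t => f (circle z r t)) : R -> C_R) t.
Proof.
  move=> Hf Hz Hr; apply: continuous_path.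
    by apply: Hf; exact: circle_in_cbox.
  by eexists; exact: is_derive_circle.
Qed.

Lemma is_RInt_circle_mean (f : C -> C) (z0 z : C) (rho r : R) :
  (forall z, cbox z0 rho z -> Ccontinuous f z) ->
  cbox z0 (rho / 2) z -> Rabs r <= rho / 2 ->
  is_RInt ((fun t => f (circle z r t)) : R -> C_R) 0 (2 * PI) (circle_mean f z r).
Proof.
  move=> Hf Hz Hr; apply: (RInt_correct (V := C_R)); apply: (ex_RInt_continuous (V := C_R)) => t _.
  exact: (continuous_on_circle _ z0 z rho).
Qed.

Lemma is_RInt_circle_moment (f : C -> C) (z0 z : C) (rho r : R) :
  (forall z, cbox z0 rho z -> Ccontinuous f z) ->
  cbox z0 (rho / 2) z -> Rabs r <= rho / 2 ->
  is_RInt ((fun t => f (circle z r t) * cisN t)%C : R -> C_R) 0 (2 * PI) (circle_moment f z r).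
Proof.
  move=> Hf Hz Hr; apply: (RInt_correct (V := C_R)); apply: (ex_RInt_continuous (V := C_R)) => t _.
  apply: continuous_RC_Cmult; first exact: (continuous_on_circle _ z0 z rho).
  apply: continuous_RC_derive; exact: is_derive_cisN.
Qed.

Section PrimitiveOnSquare.
Variables (F f : C -> C) (z0 : C) (rho : R).
Hypothesis HF : forall z, cbox z0 rho z -> is_Cderive F z (f z).
Hypothesis Hf : forall z, cbox z0 rho z -> Ccontinuous f z.
Let HFc : forall z, cbox z0 rho z -> Ccontinuous F z.
Proof. by move=> z /HF; exact: is_Cderive_continuous. Qed.

(** Integration by parts: [F (circle z r t) * (Ci * cisN t)] has the difference of the two
    integrands as its derivative, because [Ci * Ci = - 1] and [cis t * cisN t = 1], and it takes
    equal values at [0] and [2 * PI]. *)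
Lemma circle_moment_mean (z : C) (r : R) :
  cbox z0 (rho / 2) z -> Rabs r <= rho / 2 ->
  circle_moment F z r = (RtoC r * circle_mean f z r)%C.
Proof.
  move=> Hz Hr.
  have I1 := is_RInt_circle_moment F z0 z rho r HFc Hz Hr.
  have I2 := is_RInt_Cmult (RtoC r) _ _ _ _ (is_RInt_circle_mean f z0 z rho r Hf Hz Hr).
  have I3 : is_RInt ((fun t => F (circle z r t) * cisN t - RtoC r * f (circle z r t))%C : R -> C_R)
     0 (2 * PI) (circle_moment F z r - RtoC r * circle_mean f z r)%C.
    exact: (is_RInt_minus (V := C_R)).
  have I4 : is_RInt ((fun t => F (circle z r t) * cisN t - RtoC r * f (circle z r t))%C : R -> C_R)
     0 (2 * PI) (minus (F (circle z r (2 * PI)) * (Ci * cisN (2 * PI)))%C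
                  (F (circle z r 0) * (Ci * cisN 0))%C : C_R).
    apply: (is_RInt_derive (V := C_R) (fun t => F (circle z r t) * (Ci * cisN t))%C) => t _.
    - have -> : (F (circle z r t) * cisN t - RtoC r * f (circle z r t) =
        (f (circle z r t) * (RtoC r * (Ci * cis t))) * (Ci * cisN t)
          + F (circle z r t) * (0 * cisN t + Ci * (- Ci * cisN t)))%C.
        have E : (Ci * Ci = - 1)%C by rewrite /Ci /Cmult /Copp /RtoC /=; f_equal; ring.
        transitivity (F (circle z r t) * cisN t - RtoC r * f (circle z r t) * (cis t * cisN t))%C;
          first by rewrite cis_cisN; ring.
        transitivity ((Ci * Ci) * (f (circle z r t) * (RtoC r * cis t) * cisN t)
          - (Ci * Ci) * (F (circle z r t) * cisN t))%C; last by ring.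
        rewrite E; ring.
      apply: is_derive_RC_Cmult.
        apply: is_derive_comp_path; last exact: is_derive_circle.
        by apply: HF; exact: circle_in_cbox.
      apply: (is_derive_RC_Cmult (fun _ => Ci)); last exact: is_derive_cisN.
      exact: (is_derive_const (V := C_R)).
    - apply: (continuous_minus (V := C_R)).
        apply: continuous_RC_Cmult; first exact: (continuous_on_circle _ z0 z rho).
        apply: continuous_RC_derive; exact: is_derive_cisN.
      apply: continuous_RC_Cmult; first exact: continuous_const.
      exact: (continuous_on_circle _ z0 z rho).
  have E : (circle_moment F z r - RtoC r * circle_mean f z r)%C = 0%C.
    rewrite -(is_RInt_unique (V := C_R) _ _ _ _ I3) (is_RInt_unique (V := C_R) _ _ _ _ I4).
    have -> : circle z r (2 * PI) = circle z r 0 by rewrite /circle /cis cos_2PI sin_2PI cos_0 sin_0.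
    have -> : cisN (2 * PI) = cisN 0 by rewrite /cisN cos_2PI sin_2PI cos_0 sin_0.
    exact: minus_eq_zero.
  transitivity ((circle_moment F z r - RtoC r * circle_mean f z r) + RtoC r * circle_mean f z r)%C;
    first by ring.
  rewrite E; ring.
Qed.

(** The common estimate behind differentiation in the radius and in the center. [J] is the
    first-order change of the moment when the circle moves by at most [m]; the error comes from
    uniform differentiability of [F] with tolerance [e / 8]. *)
Lemma circle_moment_perturb (e : R) : 0 < e ->
  exists d, 0 < d /\ forall (z z' : C) (r r' m : R) (J : C),
    cbox z0 (rho / 2) z -> cbox z0 (rho / 2) z' -> Rabs r <= rho / 2 -> Rabs r' <= rho / 2 ->
    m < d -> (forall t, Cmod (circle z' r' t - circle z r t) <= m) ->
    is_RInt ((fun t => f (circle z r t) * (circle z' r' t - circle z r t) * cisN t)%C : R -> C_R)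
      0 (2 * PI) J ->
    Cmod (circle_moment F z' r' - circle_moment F z r - J) <= e * m.
Proof.
  move=> e0; have e8 : 0 < e / 8 by lra.
  have [d [d0 Hd]] := cbox_uniform_differentiability F f z0 rho (e / 8) HF Hf e8.
  exists d; split => // z z' r r' m J Hz Hz' Hr Hr' Hm Hh HJ.
  have m0 : 0 <= m by apply: Rle_trans (Hh 0); exact: Cmod_ge_0.
  have I1 := is_RInt_circle_moment F z0 z rho r HFc Hz Hr.
  have I2 := is_RInt_circle_moment F z0 z' rho r' HFc Hz' Hr'.
  have I := is_RInt_minus (V := C_R) _ _ _ _ _ _ (is_RInt_minus (V := C_R) _ _ _ _ _ _ I2 I1) HJ.
  have -> : e * m = 8 * (e / 8 * m) by field.
  apply: (Cmod_RInt_circle_le _ _ _ _ _ I); first by nra.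
  move=> t.
  have -> : minus (minus (F (circle z' r' t) * cisN t)%C (F (circle z r t) * cisN t)%C : C_R)
      (f (circle z r t) * (circle z' r' t - circle z r t) * cisN t)%C =
     ((F (circle z' r' t) - F (circle z r t)
       - f (circle z r t) * (circle z' r' t - circle z r t)) * cisN t)%C.
    have R : (F (circle z' r' t) * cisN t - F (circle z r t) * cisN t -
        f (circle z r t) * (circle z' r' t - circle z r t) * cisN t =
      (F (circle z' r' t) - F (circle z r t)
       - f (circle z r t) * (circle z' r' t - circle z r t)) * cisN t)%C by ring.
    exact: R.
  rewrite Cmod_mult Cmod_cisN Rmult_1_r.
  apply: Rle_trans (Hd _ _ _ _ _) _; try exact: circle_in_cbox.
    by apply: Rle_lt_trans Hm.
  apply: Rmult_le_compat_l => //; lra.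
Qed.

(** Changing the radius moves the point at angle [t] by a multiple of [cis t], which cancels against
    the weight [cisN t] and leaves the unweighted mean of [f]. *)
Lemma circle_moment_derive_radius (z : C) (r : R) :
  cbox z0 (rho / 2) z -> 0 < r < rho / 2 ->
  is_derive (circle_moment F z : R -> C_R) r (circle_mean f z r).
Proof.
  move=> Hz Hr; apply/is_derive_RC_eps => e e0.
  have [d [d0 Hd]] := circle_moment_perturb e e0.
  exists (Rmin d (Rmin r (rho / 2 - r))); split.
    by repeat apply: Rmin_pos => //; lra.
  move=> s Hs.
  have S1 : Rabs (s - r) < d by apply: Rlt_le_trans Hs (Rmin_l _ _).
  have S2 : Rabs (s - r) < r by apply: Rlt_le_trans Hs (Rle_trans _ _ _ (Rmin_r _ _) (Rmin_l _ _)).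
  have S3 : Rabs (s - r) < rho / 2 - r
    by apply: Rlt_le_trans Hs (Rle_trans _ _ _ (Rmin_r _ _) (Rmin_r _ _)).
  have E t : (circle z s t - circle z r t = RtoC (s - r) * cis t)%C.
    by rewrite /circle RtoC_minus; ring.
  have Hr' : Rabs r <= rho / 2 by apply: Rabs_le; lra.
  apply: Hd => //.
  - apply: Rabs_le; move: S2 S3 => /Rabs_lt_between S2 /Rabs_lt_between S3; lra.
  - by move=> t; rewrite E Cmod_mult Cmod_cis Cmod_R; lra.
  - rewrite Cmult_comm.
    apply: (is_RInt_ext (V := C_R) (fun t => RtoC (s - r) * f (circle z r t))%C).
      move=> t _; rewrite E.
      have R : (RtoC (s - r) * f (circle z r t) =
        f (circle z r t) * (RtoC (s - r) * cis t) * cisN t)%C.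
        transitivity (RtoC (s - r) * f (circle z r t) * (cis t * cisN t))%C; last by ring.
        by rewrite cis_cisN; ring.
      exact: R.
    apply: is_RInt_Cmult; exact: (is_RInt_circle_mean f z0 z rho).
Qed.

(** The mean is differentiated through the quotient of [circle_moment F z t] by [t], since [f] is
    only continuous. The two terms of the quotient rule cancel because the derivative of the moment
    is the moment over [t]. *)
Lemma circle_mean_const (z : C) (r s : R) :
  cbox z0 (rho / 2) z -> 0 < r -> r < s -> s < rho / 2 ->
  circle_mean f z r = circle_mean f z s.
Proof.
  move=> Hz r0 rs sr.
  have E t : r <= t <= s -> circle_mean f z t = (RtoC (/ t) * circle_moment F z t)%C.
    move=> Ht; rewrite circle_moment_mean //; last by apply: Rabs_le; lra.
    rewrite Cmult_assoc -RtoC_mult Rinv_l; [ring | lra].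
  rewrite !E; try lra.
  apply: (eq_is_derive (V := C_R) (fun t => RtoC (/ t) * circle_moment F z t)%C) => // t Ht.
  evar_last.
    apply: is_derive_RC_Cmult; last by apply: circle_moment_derive_radius => //; lra.
    apply/is_derive_RC_components.
    instantiate (1 := RtoC (- / t ^ 2)); split; rewrite /=.
      by auto_derive; [lra | field; lra].
    exact: (is_derive_const (V := R_NormedModule)).
  rewrite E //.
  have -> : - / t ^ 2 = - (/ t * / t) by field; lra.
  rewrite RtoC_opp RtoC_mult.
  have R : (- (RtoC (/ t) * RtoC (/ t)) * circle_moment F z t +
    RtoC (/ t) * (RtoC (/ t) * circle_moment F z t) = 0)%C by ring.
  exact: R.
Qed.

(** The mean does not depend on the radius, so it may be computed on arbitrarily small circles,
    where [f] is close to [f z]. *)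
Lemma circle_mean_value (z : C) (r : R) :
  cbox z0 (rho / 2) z -> 0 < r < rho / 2 ->
  circle_mean f z r = (RtoC (2 * PI) * f z)%C.
Proof.
  move=> Hz Hr.
  have Hz' : cbox z0 rho z by case: Hz => H1 H2; split; lra.
  have key e : 0 < e -> Cmod (circle_mean f z r - RtoC (2 * PI) * f z) <= 8 * e.
    move=> e0.
    have [d [d0 Hd]] := cbox_uniform_continuity f z0 rho e Hf e0.
    (* [d / 2] places the small circle where [f] varies by at most [e]; [r / 2] ensures [s < r], as
       [circle_mean_const] demands. *)
    set s := Rmin (d / 2) (r / 2).
    have s0 : 0 < s by apply: Rmin_pos; lra.
    have sd : s <= d / 2 by exact: Rmin_l.
    have sr : s <= r / 2 by exact: Rmin_r.
    rewrite -(circle_mean_const z s r) //; try lra.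
    have Hs : Rabs s <= rho / 2 by apply: Rabs_le; lra.
    have I1 := is_RInt_circle_mean f z0 z rho s Hf Hz Hs.
    have I2 := is_RInt_const (V := C_R) 0 (2 * PI) (f z).
    have I3 := is_RInt_minus (V := C_R) _ _ _ _ _ _ I1 I2.
    have E : (circle_mean f z s - RtoC (2 * PI) * f z)%C =
      minus (circle_mean f z s) (scal (2 * PI - 0) (f z : C_R)).
      rewrite /minus /Cminus /plus /opp /scal /=; f_equal; f_equal.
      case: (f z) => a b; rewrite /Cmult /RtoC /prod_scal /scal /= /mult /=; f_equal; ring.
    rewrite E.
    apply: (Cmod_RInt_circle_le _ _ _ _ _ I3); first by lra.
    move=> t; apply: Hd => //; first exact: circle_in_cbox.
    have -> : (circle z s t - z = RtoC s * cis t)%C by rewrite /circle; ring.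
    by rewrite Cmod_mult Cmod_cis Cmod_R Rabs_pos_eq; lra.
  have Z : Cmod (circle_mean f z r - RtoC (2 * PI) * f z) = 0.
    apply: Rle_antisym; last exact: Cmod_ge_0.
    apply: Rnot_lt_le => Hpos; set M := Cmod _ in Hpos.
    have := key (M / 16) ltac:(lra); rewrite -/M; lra.
  have := Cmod_eq_0 _ Z => H.
  transitivity ((circle_mean f z r - RtoC (2 * PI) * f z) + RtoC (2 * PI) * f z)%C; first by ring.
  rewrite H; ring.
Qed.

(** Moving the center translates every point of the circle by the same [w - z], which comes out of
    the first-order term. The derivative falls on [F], so continuity of [f] suffices. *)
Lemma circle_moment_derive_center (z : C) (r : R) :
  Rabs (fst z - fst z0) < rho / 2 -> Rabs (snd z - snd z0) < rho / 2 -> Rabs r <= rho / 2 ->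
  is_Cderive (fun w => circle_moment F w r) z (circle_moment f z r).
Proof.
  move=> Hx Hy Hr; apply/is_Cderive_eps => e e0.
  have [d [d0 Hd]] := circle_moment_perturb e e0.
  set d2 := Rmin (rho / 2 - Rabs (fst z - fst z0)) (rho / 2 - Rabs (snd z - snd z0)).
  exists (Rmin d d2); split.
    by apply: Rmin_pos => //; apply: Rmin_pos; lra.
  move=> w Hw.
  have W1 : Cmod (w - z) < d by apply: Rlt_le_trans Hw (Rmin_l _ _).
  have W2 : Cmod (w - z) < d2 by apply: Rlt_le_trans Hw (Rmin_r _ _).
  have W3 := Rlt_le_trans _ _ _ W2 (Rmin_l _ _).
  have W4 := Rlt_le_trans _ _ _ W2 (Rmin_r _ _).
  have Hz : cbox z0 (rho / 2) z by split; lra.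
  have E t : (circle w r t - circle z r t = w - z)%C by rewrite /circle; ring.
  apply: Hd => //.
  - split.
      have -> : fst w - fst z0 = fst (w - z)%C + (fst z - fst z0) by rewrite /=; ring.
      apply: Rle_trans (Rabs_triang _ _) _; have := Cmod_bound_fst (w - z); lra.
    have -> : snd w - snd z0 = snd (w - z)%C + (snd z - snd z0) by rewrite /=; ring.
    apply: Rle_trans (Rabs_triang _ _) _; have := Cmod_bound_snd (w - z); lra.
  - by move=> t; rewrite E; lra.
  - rewrite Cmult_comm.
    apply: (is_RInt_ext (V := C_R) (fun t => (w - z) * (f (circle z r t) * cisN t))%C).
      move=> t _; rewrite E.
      have R : ((w - z) * (f (circle z r t) * cisN t) = f (circle z r t) * (w - z) * cisN t)%C
        by ring.
      exact: R.
    apply: is_RInt_Cmult; exact: (is_RInt_circle_moment f z0 z rho).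
Qed.

Lemma circle_moment_continuous_center (z : C) (r : R) :
  Rabs (fst z - fst z0) < rho / 2 -> Rabs (snd z - snd z0) < rho / 2 -> Rabs r <= rho / 2 ->
  Ccontinuous (fun w => circle_moment f w r) z.
Proof.
  move=> Hx Hy Hr; apply/continuous_C_eps => e e0.
  (* The circle estimate multiplies by 8, which leaves [e / 2] and hence the strict inequality. *)
  have e16 : 0 < e / 16 by lra.
  have [d [d0 Hd]] := cbox_uniform_continuity f z0 rho _ Hf e16.
  set d2 := Rmin (rho / 2 - Rabs (fst z - fst z0)) (rho / 2 - Rabs (snd z - snd z0)).
  exists (Rmin d d2); split.
    by apply: Rmin_pos => //; apply: Rmin_pos; lra.
  move=> w Hw.
  have W1 : Cmod (w - z) < d by apply: Rlt_le_trans Hw (Rmin_l _ _).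
  have W2 : Cmod (w - z) < d2 by apply: Rlt_le_trans Hw (Rmin_r _ _).
  have W3 := Rlt_le_trans _ _ _ W2 (Rmin_l _ _).
  have W4 := Rlt_le_trans _ _ _ W2 (Rmin_r _ _).
  have Hz : cbox z0 (rho / 2) z by split; lra.
  have E t : (circle w r t - circle z r t = w - z)%C by rewrite /circle; ring.
  have Hzw : cbox z0 (rho / 2) w.
    split.
      have -> : fst w - fst z0 = fst (w - z)%C + (fst z - fst z0) by rewrite /=; ring.
      apply: Rle_trans (Rabs_triang _ _) _; have := Cmod_bound_fst (w - z); lra.
    have -> : snd w - snd z0 = snd (w - z)%C + (snd z - snd z0) by rewrite /=; ring.
    apply: Rle_trans (Rabs_triang _ _) _; have := Cmod_bound_snd (w - z); lra.
  have I1 := is_RInt_circle_moment f z0 z rho r Hf Hz Hr.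
  have I2 := is_RInt_circle_moment f z0 w rho r Hf Hzw Hr.
  have I := is_RInt_minus (V := C_R) _ _ _ _ _ _ I2 I1.
  suff : Cmod (circle_moment f w r - circle_moment f z r) <= 8 * (e / 16) by lra.
  apply: (Cmod_RInt_circle_le _ _ _ _ _ I); first by lra.
  move=> t.
  have R : (f (circle w r t) * cisN t - f (circle z r t) * cisN t =
    (f (circle w r t) - f (circle z r t)) * cisN t)%C by ring.
  change (Cmod (f (circle w r t) * cisN t - f (circle z r t) * cisN t) <= e / 16); rewrite R.
  rewrite Cmod_mult Cmod_cisN Rmult_1_r.
  by apply: Hd; try exact: circle_in_cbox; rewrite E.
Qed.

End PrimitiveOnSquare.

(** * Derivatives of holomorphic functions *)

Lemma is_Cderive_ext_near (f g : C -> C) (z l : C) (d : R) :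
  0 < d -> (forall w, Cmod (w - z) < d -> f w = g w) -> is_Cderive f z l -> is_Cderive g z l.
Proof.
  move=> d0 H; apply: is_derive_ext_loc.
  by exists (mkposreal d d0) => w Hw; apply: H.
Qed.

Lemma is_Cderive_Cmult_const (c : C) (f : C -> C) (z l : C) :
  is_Cderive f z l -> is_Cderive (fun w => c * f w)%C z (c * l)%C.
Proof.
  move=> /is_Cderive_eps H; apply/is_Cderive_eps => e e0.
  have c0 := Cmod_ge_0 c.
  have e1 : 0 < e / (Cmod c + 1) by apply: Rdiv_lt_0_compat; lra.
  have [d [d0 Hd]] := H _ e1.
  exists d; split => // w Hw.
  have -> : (c * f w - c * f z - c * l * (w - z) = c * (f w - f z - l * (w - z)))%C by ring.
  rewrite Cmod_mult.
  have := Rmult_le_compat_l (Cmod c + 1) _ _ ltac:(lra) (Hd w Hw).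
  rewrite -Rmult_assoc.
  have -> : (Cmod c + 1) * (e / (Cmod c + 1)) = e by field; lra.
  have := Cmod_ge_0 (f w - f z - l * (w - z)); nra.
Qed.

(** Near [z0], [f z] equals [circle_moment F z r / (2 * PI * r)] for one fixed radius. This
    expression is differentiable in [z], and its derivative, the same multiple of the moment of [f],
    is continuous. *)
Lemma primitive_C1 (F f : C -> C) (z0 : C) (rho : R) :
  0 < rho ->
  (forall z, cbox z0 rho z -> is_Cderive F z (f z)) ->
  (forall z, cbox z0 rho z -> Ccontinuous f z) ->
  exists g, (forall z, Cmod (z - z0) < rho / 4 -> is_Cderive f z (g z)) /\ Ccontinuous g z0.
Proof.
  move=> rho0 HF Hf.
  (* The radius must stay strictly below [rho / 2] for the mean value formula. The formula then
     holds on the disc of radius [rho / 2], which contains a disc of radius [rho / 4] around each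
     point where the derivative is claimed. *)
  set r := rho / 4; have Er : r = rho / 4 by [].
  have PI0 := PI_RGT_0.
  have Hr : Rabs r <= rho / 2 by apply: Rabs_le; rewrite /r; lra.
  set c := RtoC (/ (2 * PI * r)).
  have Hc : (c * (RtoC r * RtoC (2 * PI)) = 1)%C.
    rewrite /c -!RtoC_mult; f_equal; field; rewrite /r; lra.
  have near z : Cmod (z - z0) < rho / 2 ->
      Rabs (fst z - fst z0) < rho / 2 /\ Rabs (snd z - snd z0) < rho / 2.
    move=> H; split; apply: Rle_lt_trans H;
      [exact: (Cmod_bound_fst (z - z0)) | exact: (Cmod_bound_snd (z - z0))].
  have E z : Cmod (z - z0) < rho / 2 -> (c * circle_moment F z r)%C = f z.
    move=> /near [H1 H2].
    have Hz : cbox z0 (rho / 2) z by split; lra.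
    rewrite (circle_moment_mean F f z0 rho) // (circle_mean_value F f z0 rho) //;
      last by rewrite /r; lra.
    transitivity (c * (RtoC r * RtoC (2 * PI)) * f z)%C; first by ring.
    by rewrite Hc; ring.
  exists (fun z => c * circle_moment f z r)%C; split.
  - move=> z Hz.
    have [|H1 H2] := near z; first by lra.
    apply: (is_Cderive_ext_near (fun w => c * circle_moment F w r)%C f z _ (rho / 4)); first by lra.
      move=> w Hw; apply: E.
      have -> : (w - z0 = (w - z) + (z - z0))%C by ring.
      apply: Rle_lt_trans (Cmod_triangle _ _) _; lra.
    apply: is_Cderive_Cmult_const.
    exact: (circle_moment_derive_center F f z0 rho).
  - have K := circle_moment_continuous_center f z0 rho Hf z0 r.
    have [|H1 H2] := near z0.
      have -> : (z0 - z0 = 0)%C by ring.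
      rewrite Cmod_0; lra.
    have /continuous_C_eps K1 := K H1 H2 Hr.
    apply/continuous_C_eps => e e0.
    have c0 := Cmod_ge_0 c.
    have [|d [d0 Hd]] := K1 (e / (Cmod c + 1)); first by apply: Rdiv_lt_0_compat; lra.
    exists d; split => // w Hw.
    have -> : (c * circle_moment f w r - c * circle_moment f z0 r =
      c * (circle_moment f w r - circle_moment f z0 r))%C by ring.
    rewrite Cmod_mult.
    have := Rmult_lt_compat_l (Cmod c + 1) _ _ ltac:(lra) (Hd w Hw).
    have -> : (Cmod c + 1) * (e / (Cmod c + 1)) = e by field; lra.
    have := Cmod_ge_0 (circle_moment f w r - circle_moment f z0 r); nra.
Qed.

Lemma open_cbox (D : C -> Prop) (z : C) :
  open D -> D z -> exists rho, 0 < rho /\ forall w, cbox z rho w -> D w.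
Proof.
  move=> HD /HD [e He]; exists (e / 2).
  have e0 := cond_pos e.
  split; first lra.
  by move=> w [H1 H2]; apply: He; split; rewrite /ball /= /AbsRing_ball /abs /= /minus /plus /opp /=
    -/(Rminus _ _); lra.
Qed.

Lemma holomorphic_is_Cderive (D : C -> Prop) (f : C -> C) (z : C) :
  holomorphic_on D f -> D z -> is_Cderive f z (C_derive f z).
Proof. by move=> Hf /Hf [l Hl]; rewrite (is_C_derive_unique _ _ _ Hl). Qed.

(** Goursat supplies a local primitive of [f], to which [primitive_C1] applies; the resulting [g]
    agrees with [C_derive f] near [z]. *)
Lemma holomorphic_C1 (D : C -> Prop) (f : C -> C) :
  open D -> holomorphic_on D f -> forall z, D z -> Ccontinuous (C_derive f) z.
Proof.
  move=> HD Hf z Dz.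
  have [rho [rho0 Hrho]] := open_cbox D z HD Dz.
  have [w Hw|F HF] := box_primitive f z rho.
    by eexists; apply: (holomorphic_is_Cderive D) => //; exact: Hrho.
  (* [box_primitive] differentiates [F] only in the interior of the square, so the closed square is
     halved. A quarter of [rho / 2] then gives the radius [rho / 8] used below. *)
  have [|w [H1 H2]|w [H1 H2]|g [Hg Hgc]] := primitive_C1 F f z (rho / 2).
  - lra.
  - by apply: HF; lra.
  - apply: (is_Cderive_continuous _ _ (C_derive f w)).
    by apply: (holomorphic_is_Cderive D) => //; apply: Hrho; split; lra.
  - apply: (continuous_ext_loc (T := C_UniformSpace) (U := C_UniformSpace) _ g) => //.
    have r8 : 0 < rho / 8 by lra.
    apply/locally_C; exists (mkposreal _ r8) => w Hw.
    symmetry; apply: is_C_derive_unique; apply: Hg.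
    have : Cmod (w - z) < rho / 8 by exact: Hw.
    lra.
Qed.

(** Now [f] itself is the primitive, and [C_derive f] is the continuous function to be
    differentiated. *)
Lemma holomorphic_C_derive (D : C -> Prop) (f : C -> C) :
  open D -> holomorphic_on D f -> holomorphic_on D (C_derive f).
Proof.
  move=> HD Hf z Dz.
  have [rho [rho0 Hrho]] := open_cbox D z HD Dz.
  have [||w /Hrho Dw|g [Hg _]] := primitive_C1 f (C_derive f) z rho => //.
  - by move=> w /Hrho; exact: (holomorphic_is_Cderive D).
  - exact: (holomorphic_C1 D).
  - exists (g z); apply: Hg.
    have -> : (z - z = 0)%C by ring.
    rewrite Cmod_0; lra.
Qed.

(** * Harmonic functions *)

Lemma open_locally_x (D : C -> Prop) (z : C) :
  open D -> D z -> locally (Re z) (fun t => D (t, Im z)).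
Proof.
  move=> HD /HD [e He]; exists e => t Ht; apply: He; split => //=; exact: ball_center.
Qed.

Lemma open_locally_y (D : C -> Prop) (z : C) :
  open D -> D z -> locally (Im z) (fun t => D (Re z, t)).
Proof.
  move=> HD /HD [e He]; exists e => t Ht; apply: He; split => //=; exact: ball_center.
Qed.

(** On the horizontal and vertical lines through [z] the velocities are [1] and [Ci]; as [D] is
    open, [u] and the real part of [f] agree on these lines near [z]. *)
Lemma partials_Re (D : C -> Prop) (f : C -> C) (u : C -> R) (z l : C) :
  open D -> D z -> (forall w, D w -> u w = Re (f w)) -> is_Cderive f z l ->
  is_derive (fun t => u (t, Im z)) (Re z) (Re l) /\
  is_derive (fun t => u (Re z, t)) (Im z) (Re (l * Ci)).
Proof.
  move=> HD Dz Hu Hf; split.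
  - apply: (is_derive_ext_loc (fun t => Re (f (t, Im z)))).
      by apply: filter_imp (open_locally_x D z HD Dz) => t Ht; rewrite Hu.
    have H : is_derive ((fun t => f (hpath (Im z) t)) : R -> C_R) (Re z) (l * RtoC 1)%C.
      apply: is_derive_comp_path; last exact: is_derive_hpath.
      by rewrite /hpath -surjective_pairing.
    move/is_derive_RC_components: H => [H _].
    by rewrite Cmult_1_r in H.
  - apply: (is_derive_ext_loc (fun t => Re (f (Re z, t)))).
      by apply: filter_imp (open_locally_y D z HD Dz) => t Ht; rewrite Hu.
    have H : is_derive ((fun t => f (vpath (Re z) t)) : R -> C_R) (Im z) (l * Ci)%C.
      apply: is_derive_comp_path; last exact: is_derive_vpath.
      by rewrite /vpath -surjective_pairing.
    by move/is_derive_RC_components: H => [H _].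
Qed.

Lemma partial_Re (D : C -> Prop) (f : C -> C) (u : C -> R) (z l : C) :
  open D -> D z -> (forall w, D w -> u w = Re (f w)) -> is_Cderive f z l ->
  has_partials u z /\ partial_x u z = Re l /\ partial_y u z = Re (Ci * l).
Proof.
  move=> HD Dz Hu Hf.
  have [H1 H2] := partials_Re D f u z l HD Dz Hu Hf.
  split; first by split; [exists (Re l) | exists (Re (l * Ci))].
  split; first exact: is_derive_unique.
  rewrite Cmult_comm; exact: is_derive_unique.
Qed.

Lemma holomorphic_Cmult_const (D : C -> Prop) (c : C) (f : C -> C) :
  holomorphic_on D f -> holomorphic_on D (fun w => c * f w)%C.
Proof. by move=> Hf z /Hf [l Hl]; exists (c * l)%C; exact: is_Cderive_Cmult_const. Qed.

(** Induction on the order, for all [f] and [u] at once: the partial derivatives of [u] are the real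
    parts of [C_derive f] and [Ci * C_derive f], which are again holomorphic. *)
Lemma smooth_Re (D : C -> Prop) (f : C -> C) (u : C -> R) :
  open D -> holomorphic_on D f -> (forall z, D z -> u z = Re (f z)) -> smooth_on D u.
Proof.
  move=> HD Hf Hu k; elim: k f u Hf Hu => [|k IH] f u Hf Hu.
  (* The continuity clause is common to order zero and to the inductive step, so it is proved in
     both goals in parallel. *)
  all: have Hc z : D z -> continuous u z.
  1,3: move=> Dz.
  1,2: apply: (continuous_ext_loc (T := C_UniformSpace) _ (fun w => Re (f w))).
  1,3: by apply: filter_imp (HD z Dz) => w Dw; rewrite Hu.
  1,2: apply: (continuous_comp (U := C_UniformSpace) (V := C_UniformSpace) f Re).
  1,3: by apply: is_Cderive_continuous; apply: (holomorphic_is_Cderive D).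
  1,2: by case: (f z) => a b; exact: continuous_fst.
  - by split.
  - have P z (Dz : D z) := partial_Re D f u z _ HD Dz Hu (holomorphic_is_Cderive D f z Hf Dz).
    have Hf' := holomorphic_C_derive D f HD Hf.
    split => //; split; first by move=> z /P [].
    split.
      by apply: (IH (C_derive f)) => // z /P [_ []].
    apply: (IH (fun z => Ci * C_derive f z)%C); last by move=> z /P [_ []].
    exact: holomorphic_Cmult_const.
Qed.

(** Differentiating twice in [y] multiplies the second complex derivative by [Ci * Ci = - 1], so the
    two second-order terms cancel. *)
Lemma harmonic_Re (D : C -> Prop) (f : C -> C) (u : C -> R) :
  open D -> holomorphic_on D f -> (forall z, D z -> u z = Re (f z)) -> harmonic_on D u.
Proof.
  move=> HD Hf Hu; split; first exact: (smooth_Re D f u).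
  have Hf' := holomorphic_C_derive D f HD Hf.
  have P z (Dz : D z) := partial_Re D f u z _ HD Dz Hu (holomorphic_is_Cderive D f z Hf Dz).
  move=> z Dz.
  have H := holomorphic_is_Cderive D _ z Hf' Dz.
  have [_ [-> _]] := partial_Re D (C_derive f) (partial_x u) z _ HD Dz
    (fun w Dw => proj1 (proj2 (P w Dw))) H.
  have [_ [_ ->]] := partial_Re D (fun w => Ci * C_derive f w)%C (partial_y u) z _ HD Dz
    (fun w Dw => proj2 (proj2 (P w Dw))) (is_Cderive_Cmult_const Ci _ _ _ H).
  rewrite /=; ring.
Qed.

(** * Real differentials, the Cauchy-Riemann equations and smoothness of harmonic functions *)

Lemma C1_filterdiff (D : C -> Prop) (u : C -> R) (z : C) :
  open D -> Ck_on 1 D u -> D z ->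
  filterdiff (K := R_AbsRing) (U := C_R_NormedModule) (V := R_NormedModule)
    u (locally z) (fun w => fst w * partial_x u z + snd w * partial_y u z).
Proof.
  move=> HD [_ [Hp [[Hcx _] _]]]; case: z => x y Dz.
  apply: (filterdiff_ext (K := R_AbsRing) (U := C_R_NormedModule) (V := R_NormedModule)
    (fun p : C => u (fst p, snd p))); first by case.
  apply: (is_derive_filterdiff (fun s t => u (s, t)) x y
    (fun s t => partial_x u (s, t)) (partial_y u (x, y))).
  - apply: filter_imp (HD _ Dz) => -[s t] Dst.
    by apply: Derive_correct; have [] := Hp _ Dst.
  - by apply: Derive_correct; have [] := Hp _ Dz.
  - apply: (continuous_ext (T := C_UniformSpace) (U := R_UniformSpace) (partial_x u)); first by case.
    exact: Hcx.
Qed.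

Lemma C1_eps (D : C -> Prop) (u : C -> R) (z : C) :
  open D -> Ck_on 1 D u -> D z -> forall e, 0 < e ->
  exists d, 0 < d /\ forall w, Cmod (w - z) < d ->
    Rabs (u w - u z - (fst (w - z)%C * partial_x u z + snd (w - z)%C * partial_y u z)) <=
      e * Cmod (w - z).
Proof.
  move=> HD Hu Dz e e0.
  have [_ /(_ z (fun P H => H) (mkposreal e e0)) H] := C1_filterdiff D u z HD Hu Dz.
  have [d Hd] := proj1 (locally_C z _) H.
  exists d; split; first exact: cond_pos.
  move=> w Hw; have := Hd w Hw; rewrite norm_C_R; exact.
Qed.

(** Under the two equations the real differentials of [u] and [v] together form multiplication by
    the complex number [(partial_x u z, partial_x v z)]. *)
Lemma holomorphic_of_Cauchy_Riemann (D : C -> Prop) (u v : C -> R) :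
  open D -> Ck_on 1 D u -> Ck_on 1 D v ->
  (forall z, D z -> partial_x u z = partial_y v z) ->
  (forall z, D z -> partial_y u z = - partial_x v z) ->
  holomorphic_on D (fun z => (u z, v z)).
Proof.
  move=> HD Hu Hv CR1 CR2 z Dz.
  exists (partial_x u z, partial_x v z); apply/is_Cderive_eps => e e0.
  have e2 : 0 < e / 2 by lra.
  have [d1 [d10 H1]] := C1_eps D u z HD Hu Dz _ e2.
  have [d2 [d20 H2]] := C1_eps D v z HD Hv Dz _ e2.
  exists (Rmin d1 d2); split; first exact: Rmin_pos.
  move=> w Hw.
  have := H1 w (Rlt_le_trans _ _ _ Hw (Rmin_l _ _)).
  have := H2 w (Rlt_le_trans _ _ _ Hw (Rmin_r _ _)).
  rewrite (CR2 z Dz) -(CR1 z Dz) => B2 B1.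
  apply: Rle_trans (Cmod_le_sum _) _.
  set p := (w - z)%C in B1 B2 *.
  (* Naming the components [a] and [b] lets [ring] match the projections of the complex remainder
     with the two real remainders. *)
  suff : forall a b : R, a = u w - u z - (fst p * partial_x u z + snd p * - partial_x v z) ->
    b = v w - v z - (fst p * partial_x v z + snd p * partial_x u z) ->
    Rabs a + Rabs b <= e * Cmod p by apply; rewrite /=; ring.
  by move=> a b -> ->; lra.
Qed.

Lemma continuous_continuity_2d (u : C -> R) (x y : R) :
  continuous u (x, y) -> continuity_2d_pt (fun s t => u (s, t)) x y.
Proof.
  move=> H; apply/continuity_2d_pt_filterlim.
  by apply: (filterlim_ext u) => [[]|].
Qed.

(** For this pair of functions the first Cauchy-Riemann equation is Laplace's equation, and the
    second is the symmetry of the mixed partial derivatives. *)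
Lemma harmonic_dz_holomorphic (D : C -> Prop) (h : C -> R) :
  open D -> harmonic_on D h ->
  holomorphic_on D (fun z => (partial_x h z, - partial_y h z)).
Proof.
  move=> HD [Hh Hlap].
  have [Hc [Hp [Hx Hy]]] := Hh.
  have Hy' : Ck_on 1 D (fun z => - partial_y h z).
    have [Hyc [Hyp [[Hyx _] [Hyy _]]]] := Hy.
    have Ex z : partial_x (fun z => - partial_y h z) z = - partial_x (partial_y h) z.
      exact: Derive_opp.
    have Ey z : partial_y (fun z => - partial_y h z) z = - partial_y (partial_y h) z.
      exact: Derive_opp.
    split; [|split; [|split; split => //]].
    - move=> z Dz; apply: (continuous_opp (V := R_NormedModule)); exact: Hyc.
    - move=> z /Hyp [A B]; split; exact: (ex_derive_opp (V := R_NormedModule)).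
    - move=> z Dz; apply: (continuous_ext (fun z => - partial_x (partial_y h) z)).
        by move=> w; rewrite Ex.
      apply: (continuous_opp (V := R_NormedModule)); exact: Hyx.
    - move=> z Dz; apply: (continuous_ext (fun z => - partial_y (partial_y h) z)).
        by move=> w; rewrite Ey.
      apply: (continuous_opp (V := R_NormedModule)); exact: Hyy.
  apply: holomorphic_of_Cauchy_Riemann => // z Dz.
  - have -> : partial_y (fun z => - partial_y h z) z = - partial_y (partial_y h) z
      by exact: Derive_opp.
    have := Hlap z Dz; lra.
  - have -> : partial_x (fun z => - partial_y h z) z = - partial_x (partial_y h) z
      by exact: Derive_opp.
    rewrite Ropp_involutive.
    have [_ [Hxp [_ [Hxy _]]]] := Hx; have [_ [Hyp [[Hyx _] _]]] := Hy.
    symmetry; apply: (Schwarz (fun s t => h (s, t)) (Re z) (Im z)).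
    + apply/locally_2d_locally; rewrite -surjective_pairing.
      apply: filter_imp (HD z Dz) => -[x y] Dxy /=.
      have [A1 A2] := Hp _ Dxy; have [B1 _] := Hyp _ Dxy; have [_ B2] := Hxp _ Dxy.
      by split; [|split; [|split]].
    + apply: (continuous_continuity_2d (partial_x (partial_y h))).
      rewrite -surjective_pairing; exact: Hyx.
    + apply: (continuous_continuity_2d (partial_y (partial_x h))).
      rewrite -surjective_pairing; exact: Hxy.
Qed.

(** With [g] the holomorphic function [h_x - i h_y], the partial derivatives of [h] are the real
    parts of [g] and [Ci * g], so they are smooth. *)
Lemma harmonic_smooth (D : C -> Prop) (h : C -> R) :
  open D -> harmonic_on D h -> smooth_on D h.
Proof.
  move=> HD Hh.
  have Hg := harmonic_dz_holomorphic D h HD Hh.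
  have [[Hc [Hp _]] _] := Hh.
  case => [|k]; first by split.
  split => //; split => //; split.
    exact: (smooth_Re D _ _ HD Hg).
  apply: (smooth_Re D _ _ HD (holomorphic_Cmult_const D Ci _ Hg)) => z _ /=; ring.
Qed.

(** * The differential of the map, Wirtinger derivatives and the Hopf differential *)

Lemma C1_filterdiff_triple (D : C -> Prop) (X : C -> C * R) (z : C) :
  open D -> Ck_on 1 D (X1 X) -> Ck_on 1 D (X2 X) -> Ck_on 1 D (X3 X) -> D z ->
  filterdiff (K := R_AbsRing) (U := C_R_NormedModule)
    (V := prod_NormedModule R_AbsRing C_R_NormedModule R_NormedModule) X (locally z)
    (fun w => ((fst w * partial_x (X1 X) z + snd w * partial_y (X1 X) z,
                fst w * partial_x (X2 X) z + snd w * partial_y (X2 X) z),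
               fst w * partial_x (X3 X) z + snd w * partial_y (X3 X) z)).
Proof.
  move=> HD H1 H2 H3 Dz.
  (* The target is a nested product, so pairing is used twice: for the first two coordinates, and
     then with the third. *)
  have pairing (V W : NormedModule R_AbsRing) (f : C -> V) (g : C -> W) lf lg :
    filterdiff (K := R_AbsRing) (U := C_R_NormedModule) f (locally z) lf ->
    filterdiff (K := R_AbsRing) (U := C_R_NormedModule) g (locally z) lg ->
    filterdiff (K := R_AbsRing) (U := C_R_NormedModule) (V := prod_NormedModule R_AbsRing V W)
      (fun w => (f w, g w)) (locally z) (fun w => (lf w, lg w)).
    move=> Hf Hg.
    apply: (filterdiff_comp'_2 (T := C_R_NormedModule) (W := prod_NormedModule R_AbsRing V W)
      f g (fun a b => (a, b)) z lf lg (fun a b => (a, b)) Hf Hg).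
    apply: (filterdiff_ext (fun p : prod_NormedModule R_AbsRing V W => p)); first by case.
    apply: (filterdiff_ext_lin _ (fun p : prod_NormedModule R_AbsRing V W => p)); last by case.
    exact: filterdiff_id.
  have P := pairing _ _ _ _ _ _ (pairing _ _ _ _ _ _ (C1_filterdiff D _ z HD H1 Dz)
    (C1_filterdiff D _ z HD H2 Dz)) (C1_filterdiff D _ z HD H3 Dz).
  apply: filterdiff_ext P => w; rewrite /X1 /X2 /X3.
  by case: (X w) => -[a b] c.
Qed.

(** The [x]- and [y]-derivatives of [f] are [l] and [i l], so [dz] gives [l - i (i l) = 2 l]. The
    imaginary part of [f] is treated as the real part of [- Ci * f]. *)
Lemma is_Cderive_dz (f : C -> C) (z l : C) : is_Cderive f z l -> dz f z = (2 * l)%C.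
Proof.
  move=> Hf.
  have [_ [R1 R2]] := partial_Re (fun _ => True) f (fun w => Re (f w)) z l
    (fun _ _ => filter_true) I (fun _ _ => eq_refl) Hf.
  have [_ [I1 I2]] := partial_Re (fun _ => True) (fun w => - Ci * f w)%C (fun w => Im (f w)) z
    (- Ci * l)%C (fun _ _ => filter_true) I ltac:(move=> w _; rewrite /Re /Im /=; ring)
    (is_Cderive_Cmult_const _ _ _ _ Hf).
  rewrite /dz R1 R2 I1 I2 /Re /Im /=; case: l {Hf R1 R2 I1 I2} => a b.
  rewrite /Cminus /Cplus /Copp /Cmult /Ci /RtoC /=; f_equal; ring.
Qed.

Lemma dz_real_eq (u : C -> R) (z : C) :
  dz_real u z = (partial_x u z, - partial_y u z).
Proof.
  rewrite /dz_real /dz /Re /Im /=.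
  have -> : partial_x (fun _ => 0) z = 0 by exact: Derive_const.
  have -> : partial_y (fun _ => 0) z = 0 by exact: Derive_const.
  rewrite /Cminus /Cplus /Copp /Cmult /Ci /RtoC /=.
  have -> : partial_x (fun w => u w) z = partial_x u z by [].
  have -> : partial_y (fun w => u w) z = partial_y u z by [].
  f_equal; ring.
Qed.

Theorem theorem3p1 (Omega : C -> Prop) (h : C -> R) (H L P : C -> C)
  (hOmega : simply_connected_domain Omega)
  (hh : harmonic_on Omega h)
  (hH : holomorphic_on Omega H)
  (hL : holomorphic_on Omega L)
  (hP : holomorphic_on Omega P)
  (heq : forall z, Omega z -> (dz L z * dz P z + dz_real h z ^ 2)%C = H z)
  (hne : forall z, Omega z -> Cmod (dz L z) <> Cmod (dz P z)) :
  let X : C -> C * R := fun z => ((L z + Cconj (P z))%C, h z) in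
  harmonic_immersion_on Omega X /\
  forall z, Omega z -> hopf_differential X z = H z.
Proof.
  move=> X.
  have HD : open Omega by case: hOmega => -[_ []].
  have HA : holomorphic_on Omega (fun z => L z + P z)%C.
    move=> z Dz; have [l Hl] := hL z Dz; have [p Hp] := hP z Dz.
    exists (l + p)%C; exact: (is_derive_plus (K := C_AbsRing) (V := C_NormedModule)).
  (* Conjugation reverses the sign of the imaginary part of [P], so [X2] is the imaginary part of
     [L - P], that is, the real part of [- Ci * (L - P)]. *)
  have HB : holomorphic_on Omega (fun z => - Ci * (L z - P z))%C.
    apply: holomorphic_Cmult_const.
    move=> z Dz; have [l Hl] := hL z Dz; have [p Hp] := hP z Dz.
    exists (l - p)%C; exact: (is_derive_minus (K := C_AbsRing) (V := C_NormedModule)).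
  have E1 z : Omega z -> X1 X z = Re (L z + P z) by rewrite /X1 /X /=.
  have E2 z : Omega z -> X2 X z = Re (- Ci * (L z - P z)) by move=> _; rewrite /X2 /X /=; ring.
  (* The Jacobian entries of [(X1, X2)] in terms of the complex derivatives [l] and [p]; both the
     injectivity of the differential and the Hopf differential are computed from them. *)
  have partials z : Omega z -> exists l p, dz L z = (2 * l)%C /\ dz P z = (2 * p)%C /\
      partial_x (X1 X) z = Re (l + p) /\ partial_y (X1 X) z = - Im (l + p) /\
      partial_x (X2 X) z = Im (l - p) /\ partial_y (X2 X) z = Re (l - p).
    move=> Dz; have [l Hl] := hL z Dz; have [p Hp] := hP z Dz.
    exists l, p; split; first exact: is_Cderive_dz.
    split; first exact: is_Cderive_dz.
    have [_ [-> ->]] := partial_Re Omega _ _ z (l + p)%C HD Dz E1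
      (is_derive_plus (K := C_AbsRing) (V := C_NormedModule) _ _ _ _ _ Hl Hp).
    have [_ [-> ->]] := partial_Re Omega _ _ z (- Ci * (l - p))%C HD Dz E2
      (is_Cderive_Cmult_const _ _ _ _
        (is_derive_minus (K := C_AbsRing) (V := C_NormedModule) _ _ _ _ _ Hl Hp)).
    by rewrite /=; repeat split; ring.
  have S1 := smooth_Re Omega _ _ HD HA E1.
  have S2 := smooth_Re Omega _ _ HD HB E2.
  have S3 : smooth_on Omega (X3 X) := harmonic_smooth Omega h HD hh.
  split; [split; [split|]|].
  - by [].
  - move=> z Dz; eexists; split; first exact: (C1_filterdiff_triple Omega X z HD (S1 1%nat) (S2 1%nat) (S3 1%nat) Dz).
    have [[l1 l2] [[p1 p2] [EL [EP [-> [-> [-> ->]]]]]]] := partials z Dz.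
    move=> [v1 v2] [w1 w2] [] /= Q1 Q2 _.
    have Hdet : l1 * l1 + l2 * l2 <> p1 * p1 + p2 * p2.
      move=> Heq; apply: (hne z Dz); rewrite EL EP !Cmod_mult; f_equal.
      by rewrite /Cmod /= !Rmult_1_r Heq.
    (* The first two coordinates give a linear system for [v - w] with determinant [|l|^2 - |p|^2],
       which is nonzero by [Hdet]. *)
    have A : (v1 - w1) * (l1 + p1) - (v2 - w2) * (l2 + p2) = 0 by lra.
    have B : (v1 - w1) * (l2 - p2) + (v2 - w2) * (l1 - p1) = 0 by lra.
    (* Cramer's rule: combining [A] and [B] with cofactors isolates the determinant times one
       unknown, here and in [K2]. *)
    have K1 : (l1 * l1 + l2 * l2 - (p1 * p1 + p2 * p2)) * (v1 - w1) = 0.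
      transitivity ((l1 - p1) * ((v1 - w1) * (l1 + p1) - (v2 - w2) * (l2 + p2)) +
        (l2 + p2) * ((v1 - w1) * (l2 - p2) + (v2 - w2) * (l1 - p1))); first by ring.
      rewrite A B; ring.
    have K2 : (l1 * l1 + l2 * l2 - (p1 * p1 + p2 * p2)) * (v2 - w2) = 0.
      transitivity ((l1 + p1) * ((v1 - w1) * (l2 - p2) + (v2 - w2) * (l1 - p1)) -
        (l2 - p2) * ((v1 - w1) * (l1 + p1) - (v2 - w2) * (l2 + p2))); first by ring.
      rewrite A B; ring.
    f_equal.
      by case: (Rmult_integral _ _ K1); lra.
    by case: (Rmult_integral _ _ K2); lra.
  - split; first exact: (harmonic_Re Omega _ _ HD HA E1).
    by split; first exact: (harmonic_Re Omega _ _ HD HB E2).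
  - move=> z Dz.
    rewrite -(heq z Dz) /hopf_differential.
    have [l [p [-> [-> [F1 [F2 [F3 F4]]]]]]] := partials z Dz.
    have -> : dz_real (X3 X) z = dz_real h z by [].
    have -> : dz_real (X1 X) z = (l + p)%C.
      by rewrite dz_real_eq F1 F2 Ropp_involutive -surjective_pairing.
    have -> : dz_real (X2 X) z = (- Ci * (l - p))%C.
      rewrite dz_real_eq F3 F4; case: l p {F1 F2 F3 F4} => [a b] [c d].
      by rewrite /Cminus /Cplus /Copp /Cmult /Ci /=; f_equal; ring.
    have CC : (Ci * Ci = - 1)%C by rewrite /Ci /Cmult /Copp /RtoC /=; f_equal; ring.
    (* Isolating [Ci * Ci] exposes the difference of squares [(l + p)^2 - (l - p)^2 = 4 l p], which
       is [(2 l) (2 p)]. *)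
    transitivity ((l + p) ^ 2 + (Ci * Ci) * (l - p) ^ 2 + dz_real h z ^ 2)%C; first by ring.
    rewrite CC; ring.
Qed.
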